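(* Let $\mathbb{K}$ be a field, $(R,\mathfrak{m})$ a parameter $\mathbb{K}$-algebra, $C$ a commutative $\mathbb{K}$-algebra, and $A$ a Poisson (resp. associative) $R$-deformation of $C$. Suppose $\tau : C\to C'$ is a principal localization. Then: (1) There exist a Poisson (resp. associative) $R$-deformation $A'$ of $C'$ and a homomorphism $g : A\to A'$ of Poisson (resp. associative) $R$-algebras which lifts $\tau$ (i.e. the augmentations intertwine $g$ and $\tau$). (2) Suppose $\tau' : C'\to C''$ is a homomorphism of commutative $\mathbb{K}$-algebras, $A''$ is a Poisson (resp. associative) $R$-deformation of $C''$, and $h : A\to A''$ is a homomorphism of Poisson (resp. associative) $R$-algebras lifting $\tau'\circ\tau$. Then there is a unique homomorphism of Poisson (resp. associative) $R$-algebras $g' : A'\to A''$ with $h = g'\circ g$.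
   Context: A parameter $\mathbb{K}$-algebra is a complete local noetherian commutative $\mathbb{K}$-algebra $R$ with maximal ideal $\mathfrak{m}$ and $R/\mathfrak{m}=\mathbb{K}$. An associative $R$-deformation of $C$ is a flat, $\mathfrak{m}$-adically complete ($A\cong\lim_i A/\mathfrak{m}^{i+1}A$) associative unital $R$-algebra $A$ with a $\mathbb{K}$-algebra isomorphism (augmentation) $\mathbb{K}\otimes_R A\cong C$. A Poisson $R$-deformation of $C$ is a flat $\mathfrak{m}$-adically complete commutative Poisson $R$-algebra with an isomorphism of Poisson $\mathbb{K}$-algebras $\mathbb{K}\otimes_RA\cong C$, $C$ having zero bracket. A homomorphism $\tau : C\to C'$ of commutative $\mathbb{K}$-algebras is a principal localization if $C'\cong C[s^{-1}]$ as $C$-algebras for some $s\in C$. A homomorphism $g:A\to A'$ lifts $\tau$ if composing with the augmentations $A\to C$, $A'\to C'$ gives a commutative square. *)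

(* Defs.v *)
From HB Require Import structures.
From mathcomp Require Import all_boot all_order all_algebra.
Set Implicit Arguments. Unset Strict Implicit. Unset Printing Implicit Defensive.
Import GRing.Theory.
Local Open Scope ring_scope.

(* Algebras are encoded by their structure maps: an (associative, unital)
   R-algebra is a ring A with a ring homomorphism R -> A with central image;
   a K-algebra C is a ring with a ring homomorphism K -> C.  Rings are
   "possibly zero" (pz) rings, so the zero algebra is allowed. *)

Definition ring_hom (S T : pzRingType) (f : S -> T) : Prop :=
  [/\ forall x y, f (x + y) = f x + f y,
      forall x y, f (x * y) = f x * f y & f 1 = 1].

Definition central_map (R : pzRingType) (A : pzRingType) (iA : R -> A) : Prop :=
  forall r a, iA r * a = a * iA r.

Definition is_ideal (R : comPzRingType) (I : R -> Prop) : Prop :=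
  [/\ I 0, forall x y, I x -> I y -> I (x + y) & forall r x, I x -> I (r * x)].

Definition is_maximal_ideal (R : comPzRingType) (I : R -> Prop) : Prop :=
  [/\ is_ideal I, ~ I 1 &
      forall J : R -> Prop, is_ideal J -> ~ J 1 -> (forall x, I x -> J x) ->
        forall x, J x -> I x].

Definition local_ring (R : comPzRingType) (m : R -> Prop) : Prop :=
  is_maximal_ideal m /\
  forall J : R -> Prop, is_maximal_ideal J -> forall x, J x <-> m x.

Definition ideal_gen (R : comPzRingType) (s : seq R) (x : R) : Prop :=
  exists c : nat -> R, x = \sum_(i < size s) c i * s`_i.

Definition noetherian (R : comPzRingType) : Prop :=
  forall I : R -> Prop, is_ideal I ->
    exists s : seq R, forall x, I x <-> ideal_gen s x.

Definition ideal_mul (R : comPzRingType) (I J : R -> Prop) (x : R) : Prop :=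
  exists s : seq (R * R), (forall p, p \in s -> I p.1 /\ J p.2) /\
    x = \sum_(p <- s) p.1 * p.2.

Fixpoint ideal_pow (R : comPzRingType) (I : R -> Prop) (n : nat) : R -> Prop :=
  match n with
  | 0 => fun _ => True
  | n.+1 => ideal_mul I (ideal_pow I n)
  end.

Definition ideal_submod (R : comPzRingType) (A : pzRingType) (iA : R -> A)
    (I : R -> Prop) (x : A) : Prop :=
  exists s : seq (R * A), (forall p, p \in s -> I p.1) /\
    x = \sum_(p <- s) iA p.1 * p.2.

(* m-adic completeness: the canonical map A -> lim_i A / m^(i+1) A is
   bijective (injective = separated, surjective = compatible families lift). *)
Definition madic_complete (R : comPzRingType) (m : R -> Prop) (A : pzRingType)
    (iA : R -> A) : Prop :=
  (forall x : A, (forall n, ideal_submod iA (ideal_pow m n.+1) x) -> x = 0) /\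
  (forall a : nat -> A,
     (forall n, ideal_submod iA (ideal_pow m n.+1) (a n.+1 - a n)) ->
     exists x : A, forall n, ideal_submod iA (ideal_pow m n.+1) (x - a n)).

(* Flatness of the R-module A (action r . a = iA r * a), via the
   equational criterion of flatness (no tensor products in the library). *)
Definition flat_module (R : comPzRingType) (A : pzRingType) (iA : R -> A) : Prop :=
  forall (n : nat) (r : 'I_n -> R) (x : 'I_n -> A),
    \sum_(i < n) iA (r i) * x i = 0 ->
    exists (k : nat) (a : 'I_n -> 'I_k -> R) (y : 'I_k -> A),
      (forall i, x i = \sum_(j < k) iA (a i j) * y j) /\
      (forall j, \sum_(i < n) r i * a i j = 0).

Definition parameter_algebra (K : fieldType) (R : comPzRingType) (iR : K -> R)
    (m : R -> Prop) : Prop :=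
  [/\ ring_hom iR, local_ring m, noetherian R,
      madic_complete m (fun r : R => r) &
      (* R / m = K : the composite K -> R -> R/m is bijective *)
      (forall r : R, exists k : K, m (r - iR k)) /\
      (forall k : K, m (iR k) -> k = 0)].

Definition kalg_hom (K : fieldType) (C C' : pzRingType) (iC : K -> C)
    (iC' : K -> C') (f : C -> C') : Prop :=
  ring_hom f /\ forall k, f (iC k) = iC' k.

Definition ralg_hom (R : comPzRingType) (A A' : pzRingType) (iA : R -> A)
    (iA' : R -> A') (g : A -> A') : Prop :=
  ring_hom g /\ forall r, g (iA r) = iA' r.

Definition principal_localization (C C' : comPzRingType) (tau : C -> C') : Prop :=
  exists s : C,
    [/\ (exists u : C', tau s * u = 1),
        (forall c' : C', exists (c : C) (n : nat), c' * tau s ^+ n = tau c) &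
        forall c : C, tau c = 0 -> exists n : nat, s ^+ n * c = 0].

(* Associative R-deformation (A, iA, pi) of the K-algebra (C, iC):
   pi : A -> C is the augmentation, inducing K (x)_R A = A / mA ~= C. *)
Definition assoc_deformation (K : fieldType) (R : comPzRingType) (iR : K -> R)
    (m : R -> Prop) (C : comPzRingType) (iC : K -> C) (A : pzRingType)
    (iA : R -> A) (pi : A -> C) : Prop :=
  [/\ ring_hom iA /\ central_map iA, flat_module iA, madic_complete m iA,
      kalg_hom (fun k => iA (iR k)) iC pi /\
      (forall c : C, exists a : A, pi a = c) &
      forall a : A, pi a = 0 <-> ideal_submod iA m a].

Definition poisson_bracket (R : comPzRingType) (A : comPzRingType) (iA : R -> A)
    (br : A -> A -> A) : Prop :=
  [/\ (forall a b c, br (a + b) c = br a c + br b c) /\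
      (forall a b c, br a (b + c) = br a b + br a c),
      (forall r a b, br (iA r * a) b = iA r * br a b) /\
      (forall r a b, br a (iA r * b) = iA r * br a b),
      forall a, br a a = 0,
      forall a b c, br a (br b c) + br b (br c a) + br c (br a b) = 0 &
      forall a b c, br a (b * c) = br a b * c + b * br a c].

(* Poisson R-deformation of C (C with the zero bracket). *)
Definition poisson_deformation (K : fieldType) (R : comPzRingType) (iR : K -> R)
    (m : R -> Prop) (C : comPzRingType) (iC : K -> C) (A : comPzRingType)
    (iA : R -> A) (br : A -> A -> A) (pi : A -> C) : Prop :=
  [/\ assoc_deformation iR m iC iA pi, poisson_bracket iA br &
      forall a b, pi (br a b) = 0].

Definition poisson_hom (R : comPzRingType) (A A' : comPzRingType) (iA : R -> A)
    (iA' : R -> A') (br : A -> A -> A) (br' : A' -> A' -> A') (g : A -> A') : Prop :=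
  ralg_hom iA iA' g /\ forall a b, g (br a b) = br' (g a) (g b).

(* Main.v *)
From HB Require Import structures.
Require Import Defs.
From mathcomp Require Import all_boot all_order all_algebra.
From mathcomp Require Import boolp functions ring.
Set Implicit Arguments. Unset Strict Implicit. Unset Printing Implicit Defensive.
Import GRing.Theory.
Local Open Scope ring_scope.

(** Let [f] lift the element [s] with [C' = C[1/s]].  In the associative case
    [f] need not generate an Ore set in [A], but the right [A]-module
    [A' = lim_N colim (A/m^N --f--> A/m^N --f--> ...)] always makes sense: its
    elements are sequences [u] in [A] with [u (n+1) - f u n -> 0], modulo null
    sequences, [u] standing for the limit of the [f^(-n) u n].  As [C] is
    commutative, [[A, A]] lies in [m A], so right multiplication by [f] on [A']
    differs from the invertible left one by an operator that raises the
    [m]-adic order, and is bijective.  Consequently [A'] is universal among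
    complete right [A]-modules with an element, on which [f] acts bijectively.
    This universal property turns [A'] into a ring and extends ring
    homomorphisms, derivations and hence Poisson brackets.  Flatness and
    [m^N A'] are computed on sequences, solving linear equations term by term;
    the Artin-Rees lemma makes the solutions of small equations small. *)

(** * Ideals of noetherian rings and the Artin-Rees lemma *)

(** Left multiplication by [f] commutes with right multiplications but not with left ones, so no
    product of sequences is available. Two properties replace it: the fractions f^(-k) a are dense,
    so that a linear map into a separated module on which [f] is injective is determined by its
    value at 1; and a linear map with any prescribed value at 1 exists. Left multiplication by x is
    the one with 1 |-> x, and each identity to be proved compares linear maps that agree at 1, or
    derivations that agree on the image of [A]. The obstacle to flatness is that a relation between
    classes holds between representatives only up to a null sequence. A recursion v (n+1) = f v n +
    w n gives an element of [A'] only if w is null, so the coefficients of a termwise solution must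
    be null as well. Hence the generators, and the order to which smallness is required, have to be
    independent of the index n; this is where noetherianity enters. *)

Section Ideals.
Variable R : comPzRingType.
Implicit Types (I J L m : R -> Prop) (x y z : R).

Lemma ideal0 I : is_ideal I -> I 0. Proof. by case. Qed.
Lemma idealD I x y : is_ideal I -> I x -> I y -> I (x + y).
Proof. by case=> _ h _; apply: h. Qed.
Lemma idealMl I r x : is_ideal I -> I x -> I (r * x).
Proof. by case=> _ _ h; apply: h. Qed.
Lemma idealMr I r x : is_ideal I -> I x -> I (x * r).
Proof. by rewrite mulrC; apply: idealMl. Qed.
Lemma idealN I x : is_ideal I -> I x -> I (- x).
Proof. by move=> hI Ix; rewrite -mulN1r; apply: idealMl. Qed.
Lemma idealB I x y : is_ideal I -> I x -> I y -> I (x - y).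
Proof. by move=> hI Ix Iy; apply: idealD => //; apply: idealN. Qed.
Lemma ideal_sum (T : eqType) (s : seq T) I (F : T -> R) :
  is_ideal I -> (forall i, i \in s -> I (F i)) -> I (\sum_(i <- s) F i).
Proof.
move=> hI hF; rewrite big_seq; apply: (big_ind I) => //; first exact: ideal0.
by move=> x y; apply: idealD.
Qed.

Lemma ideal_gen_nth (s : seq R) i : (i < size s)%N -> ideal_gen s s`_i.
Proof.
move=> lt_i; exists (fun j => (j == i)%:R).
rewrite (bigD1 (Ordinal lt_i)) //= eqxx mul1r big1 ?addr0 // => j.
by rewrite -val_eqE /= => /negbTE ->; rewrite mul0r.
Qed.

Lemma ideal_mul_ind I J L : is_ideal L ->
  (forall x y, I x -> J y -> L (x * y)) -> forall z, ideal_mul I J z -> L z.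
Proof.
move=> hL hIJ z [s [hs ->]]; apply: ideal_sum => // p ps.
by have [? ?] := hs p ps; apply: hIJ.
Qed.

Lemma ideal_mulM I J x y : I x -> J y -> ideal_mul I J (x * y).
Proof.
move=> Ix Jy; exists [:: (x, y)]; split; last by rewrite big_seq1.
by move=> p; rewrite inE => /eqP ->.
Qed.

Lemma is_ideal_mul I J : is_ideal I -> is_ideal (ideal_mul I J).
Proof.
move=> hI; split.
- by exists [::]; split => //; rewrite big_nil.
- move=> x y [s [hs ->]] [t [ht ->]]; exists (s ++ t); split; last by rewrite big_cat.
  by move=> p; rewrite mem_cat => /orP [/hs|/ht].
- move=> r x [s [hs ->]]; exists [seq (r * p.1, p.2) | p <- s]; split.
    move=> p /mapP [q qs ->] /=; have [? ?] := hs q qs.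
    by split=> //; apply: idealMl.
  by rewrite big_map mulr_sumr; apply: eq_bigr => p _; rewrite /= mulrA.
Qed.

Lemma is_ideal_pow m n : is_ideal m -> is_ideal (ideal_pow m n).
Proof. by move=> hm; case: n => [|n] //=; apply: is_ideal_mul. Qed.

Lemma ideal_pow_le m i j x : is_ideal m -> (i <= j)%N ->
  ideal_pow m j x -> ideal_pow m i x.
Proof.
move=> hm /subnK <-; elim: (j - i)%N => [|k IH] // h; apply: IH.
move: h; rewrite addSn /=; apply: ideal_mul_ind; first exact: is_ideal_pow.
by move=> u v _; apply: idealMl; apply: is_ideal_pow.
Qed.

(** Allows [ideal_mul_ind] to be applied to one factor of a product while the other is held
    fixed. *)
Lemma is_ideal_colon L x : is_ideal L -> is_ideal (fun y => L (x * y)).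
Proof.
move=> hL; split; first by rewrite mulr0; apply: ideal0.
- by move=> y z; rewrite mulrDr; apply: idealD.
- by move=> r y; rewrite mulrCA; apply: idealMl.
Qed.

Lemma ideal_powD m i j x : is_ideal m ->
  ideal_pow m (i + j) x -> ideal_mul (ideal_pow m i) (ideal_pow m j) x.
Proof.
move=> hm; elim: i x => [|i IH] x.
  by move=> h; rewrite -[x]mul1r; apply: ideal_mulM.
rewrite addSn /=; apply: ideal_mul_ind.
  by apply: is_ideal_mul; apply: (is_ideal_pow i.+1).
move=> u v mu /IH; apply: (ideal_mul_ind (L := fun y => _ (u * y))).
  by apply: is_ideal_colon; apply: is_ideal_mul; apply: (is_ideal_pow i.+1).
by move=> p q hp hq; rewrite mulrA; apply: ideal_mulM => //; apply: ideal_mulM.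
Qed.

Lemma ideal_powM m i j x y : is_ideal m ->
  ideal_pow m i x -> ideal_pow m j y -> ideal_pow m (i + j) (x * y).
Proof.
move=> hm hx hy; elim: i x hx => [|i IH] x.
  by move=> _; apply: idealMl => //; apply: is_ideal_pow.
rewrite mulrC; move: x; apply: (ideal_mul_ind (L := fun x => _ (y * x))).
  by apply: is_ideal_colon; apply: (is_ideal_pow (i.+1 + j)).
by move=> u v mu mv; rewrite mulrCA; apply: ideal_mulM => //; rewrite mulrC; apply: IH.
Qed.

Lemma ideal_pow_exp m x n : m x -> ideal_pow m n (x ^+ n).
Proof. by move=> mx; elim: n => [|n IH] //; rewrite exprS; apply: ideal_mulM. Qed.

Definition adjoin1 L (a : R) : R -> Prop := fun z => exists l r, L l /\ z = l + r * a.

Lemma is_ideal_adjoin1 L a : is_ideal L -> is_ideal (adjoin1 L a).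
Proof.
move=> hL; split.
- by exists 0, 0; split; [apply: ideal0 | rewrite mul0r addr0].
- move=> x y [l [r [Ll ->]]] [l' [r' [Ll' ->]]].
  by exists (l + l'), (r + r'); split; [apply: idealD | ring].
- move=> s x [l [r [Ll ->]]]; exists (s * l), (s * r).
  by split; [apply: idealMl | ring].
Qed.

Lemma sub_adjoin1 L a x : L x -> adjoin1 L a x.
Proof. by move=> Lx; exists x, 0; split=> //; rewrite mul0r addr0. Qed.

(* Each generator added to [L] costs one step: if [m^M] is contained in
   [L + (a)] and [a^k] in [L], then [m^(M k)] is contained in [L]. *)
Lemma ideal_pow_sub_radical m L (s : seq R) : is_ideal m -> is_ideal L ->
  (forall a, a \in s -> exists k, L (a ^+ k)) ->
  (forall x, m x -> exists l (c : nat -> R),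
     L l /\ x = l + \sum_(i < size s) c i * s`_i) ->
  exists M, forall x, ideal_pow m M x -> L x.
Proof.
move=> hm; elim: s L => [|a s IH] L hL hs hx.
  exists 1%N; apply: ideal_mul_ind => // u v /hx [l [c [Ll ->]]] _.
  by rewrite big_ord0 addr0; apply: idealMr.
have [k ak] := hs a (mem_head _ _).
have [||M hM] := IH (adjoin1 L a) (is_ideal_adjoin1 _ hL).
- move=> b bs; have [|j bj] := hs b; first by rewrite inE bs orbT.
  by exists j; apply: sub_adjoin1.
- move=> x /hx [l [c [Ll ->]]]; exists (l + c 0%N * a), (fun i => c i.+1); split.
    by exists l, (c 0%N).
  by rewrite big_ord_recl /= addrA.
exists (k * M)%N => x.
suff H j z : ideal_pow m (j * M) z -> adjoin1 L (a ^+ j) z.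
  by move=> /H [l [r [Ll ->]]]; apply: idealD => //; apply: idealMl.
elim: j z => [|j IHj] z.
  by move=> _; exists 0, z; split; [apply: ideal0 | rewrite expr0 mulr1 add0r].
rewrite mulSn => /ideal_powD - /(_ hm).
apply: ideal_mul_ind; first exact: is_ideal_adjoin1.
move=> u v /hM [l [r [Ll ->]]] /IHj [l' [r' [Ll' ->]]].
exists (l' * (l + r * a) + r' * a ^+ j * l), (r * r'); split.
  by apply: idealD => //; [apply: idealMr | apply: idealMl].
by rewrite exprS; ring.
Qed.

Hypothesis noethR : noetherian R.

(** The union of the chain is an ideal, and its finitely many generators all occur at a common
    stage. *)
Lemma noetherian_chain (J : nat -> R -> Prop) :
  (forall n, is_ideal (J n)) -> (forall n x, J n x -> J n.+1 x) ->
  exists n, forall k x, J k x -> J n x.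
Proof.
move=> hJ hS.
have hle i j x : (i <= j)%N -> J i x -> J j x.
  by move=> /subnK <-; elim: (j - i)%N => [|k IH] // /IH /hS.
have hU : is_ideal (fun x => exists n, J n x).
  split; first by exists 0%N; apply: ideal0.
  - move=> x y [i hi] [j hj]; exists (maxn i j); apply: idealD => //.
      by apply: hle hi; apply: leq_maxl.
    by apply: hle hj; apply: leq_maxr.
  - by move=> r x [i hi]; exists i; apply: idealMl.
have [s hs] := noethR hU.
have hgen : forall i, (i < size s)%N -> exists n, J n s`_i.
  by move=> i lt_i; apply/hs/ideal_gen_nth.
have [N hN] : exists N, forall i, (i < size s)%N -> J N s`_i.
  elim: {hs}s hgen => [|a s IH] hgen; first by exists 0%N.
  have [i hi|N hN] := IH; first exact: (hgen i.+1).
  have [n0 h0] := hgen 0%N isT; exists (maxn n0 N) => -[|i] /=.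
    by move=> _; apply: hle h0; apply: leq_maxl.
  by move=> /hN; apply: hle; apply: leq_maxr.
exists N => k x Jx; have [c ->] : ideal_gen s x by apply/hs; exists k.
by apply: ideal_sum => // i _; apply: idealMl => //; apply: hN.
Qed.

(** Otherwise a choice [F] of a strictly larger member could be iterated from [L0], against the
    ascending chain condition. *)
Lemma noetherian_max (P : (R -> Prop) -> Prop) L0 :
  (forall L, P L -> is_ideal L) -> P L0 ->
  exists L, P L /\ forall L', P L' -> (forall x, L x -> L' x) -> forall x, L' x -> L x.
Proof.
move=> hP P0; apply: contrapT => /forallNP hn.
have [F hF] : exists F : {L | P L} -> {L | P L}, forall L : {L | P L},
    (forall x, sval L x -> sval (F L) x) /\ exists x, sval (F L) x /\ ~ sval L x.
  have [|F hF] := @choice {L | P L} {L | P L} (fun L L1 : {L | P L} =>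
    (forall x, sval L x -> sval L1 x) /\ exists x, sval L1 x /\ ~ sval L x);
    last by exists F.
  move=> [L PL]; have := hn L; rewrite not_andE => -[//|].
  move=> /existsNP [L' /not_implyP [PL' /not_implyP [sub /existsNP [x /not_implyP [h1 h2]]]]].
  by exists (exist _ L' PL'); split=> //; exists x.
pose J n := sval (iter n F (exist _ L0 P0)).
have [||n hN] := @noetherian_chain J.
- by move=> n; apply: hP; rewrite /J; case: (iter _ _ _).
- by move=> n x Jx; apply: (proj1 (hF _)).
have [x [h1 h2]] := proj2 (hF (iter n F (exist _ L0 P0))).
by apply: h2; apply: (hN n.+1).
Qed.

(* Artin-Rees: take [L] maximal with [L /\ I = m^N I].  For [x] in [m], once
   the chain [(L : x^k)] is stationary, [L + (x^(k+N))] still meets [I] in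
   [m^N I]; so [x^(k+N)] is in [L], and hence [L] contains a power of [m]. *)
Lemma artin_rees m I N : is_ideal m -> is_ideal I ->
  exists M, forall x, I x -> ideal_pow m M x -> ideal_mul (ideal_pow m N) I x.
Proof.
move=> hm hI; set J := ideal_mul (ideal_pow m N) I.
have hJ : is_ideal J by apply: is_ideal_mul; apply: is_ideal_pow.
pose P L := [/\ is_ideal L, forall x, J x -> L x & forall x, L x -> I x -> J x].
have [||L [[hL JL LJ] maxL]] := @noetherian_max P J; first by move=> L [].
  by split.
have [s hs] := noethR hm.
have [||M hM] := @ideal_pow_sub_radical m L s hm hL.
- move=> a sa.
  have ma : m a by apply/hs; rewrite -(nth_index 0 sa); apply: ideal_gen_nth; rewrite index_mem.
  have [||k hk] := @noetherian_chain (fun n x => L (a ^+ n * x)).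
  + by move=> n; apply: is_ideal_colon.
  + by move=> n x; rewrite exprS -mulrA; apply: idealMl.
  exists k; apply: (maxL (adjoin1 L (a ^+ k))).
  + split; first exact: is_ideal_adjoin1.
      by move=> x /JL; apply: sub_adjoin1.
    move=> y [l [r [Ll ->]]] Iy.
    (* Multiplication by [a ^+ N] moves the element of [I] into [J], hence into [L], which puts
       a^(N+k) r in [L]; stationarity brings the exponent back to [k]. *)
    have La : L (a ^+ k * r).
      apply: (hk (N + k)%N); rewrite exprD -mulrA.
      have -> : a ^+ N * (a ^+ k * r) = a ^+ N * (l + r * a ^+ k) - a ^+ N * l by ring.
      apply: idealB => //; last exact: idealMl.
      by apply: JL; apply: ideal_mulM => //; apply: ideal_pow_exp.
    by apply: LJ => //; apply: idealD => //; rewrite mulrC.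
  + by move=> x; apply: sub_adjoin1.
  + by exists 0, 1; split; [apply: ideal0 | rewrite mul1r add0r].
- move=> x /hs [c ->]; exists 0, c.
  by split; [apply: ideal0 | rewrite add0r].
by exists M => x Ix /hM Lx; apply: LJ.
Qed.

(** Submodules of R^n are finitely generated, by induction on n: the leading coordinates form an
    ideal, whose generators lift to vectors [V i] of [S]; subtracting a combination of these leaves
    a vector with leading coordinate 0, that is, one from R^(n-1) padded by [ext]. *)
Lemma noetherian_fun_fg n (S : ('I_n -> R) -> Prop) :
  S (fun=> 0) -> (forall u v, S u -> S v -> S (fun i => u i + v i)) ->
  (forall r u, S u -> S (fun i => r * u i)) ->
  exists l (t : 'I_l -> 'I_n -> R), (forall q, S (t q)) /\
    forall v, S v -> exists c : 'I_l -> R, forall j, v j = \sum_q c q * t q j.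
Proof.
elim: n S => [|n IH] S S0 SD SM.
  by exists 0%N, (fun _ _ => 0); split=> [[]//|v _]; exists (fun=> 0) => -[].
pose I a := exists v, S v /\ v ord0 = a.
have hI : is_ideal I.
  split; first by exists (fun=> 0).
  - by move=> x y [u [Su <-]] [v [Sv <-]]; exists (fun i => u i + v i); split=> //; apply: SD.
  - by move=> r x [u [Su <-]]; exists (fun i => r * u i); split=> //; apply: SM.
have [s hs] := noethR hI.
have [V hV] : exists V : 'I_(size s) -> 'I_n.+1 -> R,
    forall i, S (V i) /\ V i ord0 = s`_i.
  have [|V hV] := @choice _ _ (fun i : 'I_(size s) => fun v => S v /\ v ord0 = s`_i);
    last by exists V.
  by move=> i; apply/hs/ideal_gen_nth.
pose ext (w : 'I_n -> R) (i : 'I_n.+1) := if unlift ord0 i is Some j then w j else 0.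
have [||| l [t [ht hg]]] := IH (fun w => S (ext w)).
- by move: S0; congr S; apply/funext => i; rewrite /ext; case: unliftP.
- move=> u v Su Sv; have := SD _ _ Su Sv; congr S; apply/funext => i.
  by rewrite /ext; case: unliftP => // _; rewrite addr0.
- move=> r u Su; have := SM r _ Su; congr S; apply/funext => i.
  by rewrite /ext; case: unliftP => // _; rewrite mulr0.
exists (size s + l)%N, (fun q => match fintype.split q with inl i => V i | inr q => ext (t q) end).
split=> [q|v Sv]; first by case: fintype.split => i; [apply: (hV i).1 | apply: ht].
have [c hc] : ideal_gen s (v ord0) by apply/hs; exists v.
pose w i := v i - \sum_(j < size s) c j * V j i.
have Sw : S w.
  have Ssum (r : seq 'I_(size s)) : S (fun i => \sum_(j <- r) c j * V j i).
    elim: r => [|j r IHr]; first by move: S0; congr S; apply/funext => i; rewrite big_nil.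
    have := SD _ _ (SM (c j) _ (hV j).1) IHr; congr S.
    by apply/funext => i; rewrite big_cons.
  have := SD _ _ Sv (SM (-1) _ (Ssum (index_enum _))).
  by congr S; apply/funext => i; rewrite mulN1r.
have [|d hd] := hg (fun j => w (lift ord0 j)).
  move: Sw; congr S; apply/funext => i; rewrite /ext; case: unliftP => [j ->|->] //.
  by rewrite /w hc; apply/eqP; rewrite subr_eq0; apply/eqP; apply: eq_bigr => j _; rewrite (hV j).2.
exists (fun q => match fintype.split q with inl i => c i | inr q => d q end) => j.
rewrite big_split_ord /=.
under eq_bigr => i _ do rewrite -[lshift _ _]/(unsplit (inl _)) unsplitK.
under [X in _ = _ + X]eq_bigr => i _ do rewrite -[rshift _ _]/(unsplit (inr _)) unsplitK.
have -> : v j = \sum_(i < size s) c i * V i j + w j by rewrite /w addrC subrK.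
congr (_ + _); case: (unliftP ord0 j) => [k ->|->].
  by rewrite hd; apply: eq_bigr => q _; rewrite /ext liftK.
rewrite /ext unlift_none big1; last by move=> i _; rewrite mulr0.
by rewrite /w hc; apply/eqP; rewrite subr_eq0; apply/eqP; apply: eq_bigr => i _; rewrite (hV i).2.
Qed.

End Ideals.

(** * Adic filtrations and flat modules *)

(* Modules are given by a scalar action [sm], so that the same filtration
   [adic] covers rings over [R] and right modules over an [R]-algebra. *)
Section Modules.
Variables (R : comPzRingType) (M : zmodType) (sm : R -> M -> M).

Definition is_module : Prop :=
  [/\ forall r x y, sm r (x + y) = sm r x + sm r y,
      forall r s x, sm (r + s) x = sm r x + sm s x,
      forall r s x, sm (r * s) x = sm r (sm s x) &
      forall x, sm 1 x = x].

Definition adic (I : R -> Prop) (x : M) : Prop :=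
  exists s : seq (R * M), (forall p, p \in s -> I p.1) /\
    x = \sum_(p <- s) sm p.1 p.2.

Definition flat_action : Prop :=
  forall (n : nat) (r : 'I_n -> R) (x : 'I_n -> M),
    \sum_(i < n) sm (r i) (x i) = 0 ->
    exists (k : nat) (a : 'I_n -> 'I_k -> R) (y : 'I_k -> M),
      (forall i, x i = \sum_(j < k) sm (a i j) (y j)) /\
      (forall j, \sum_(i < n) r i * a i j = 0).

Definition adic_complete (m : R -> Prop) : Prop :=
  (forall x, (forall n, adic (ideal_pow m n.+1) x) -> x = 0) /\
  (forall a : nat -> M, (forall n, adic (ideal_pow m n.+1) (a n.+1 - a n)) ->
     exists x, forall n, adic (ideal_pow m n.+1) (x - a n)).

Hypothesis smP : is_module.

Lemma smDr r x y : sm r (x + y) = sm r x + sm r y. Proof. by case: smP. Qed.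
Lemma smDl r s x : sm (r + s) x = sm r x + sm s x. Proof. by case: smP. Qed.
Lemma smA r s x : sm (r * s) x = sm r (sm s x). Proof. by case: smP. Qed.
Lemma sm1 x : sm 1 x = x. Proof. by case: smP. Qed.
Lemma sm0 r : sm r 0 = 0.
Proof. by apply: (addrI (sm r 0)); rewrite -smDr !addr0. Qed.
Lemma sm0r x : sm 0 x = 0.
Proof. by apply: (addrI (sm 0 x)); rewrite -smDl !addr0. Qed.
Lemma smN r x : sm r (- x) = - sm r x.
Proof. by apply: (addrI (sm r x)); rewrite -smDr !subrr sm0. Qed.
Lemma smB r x y : sm r (x - y) = sm r x - sm r y.
Proof. by rewrite smDr smN. Qed.
Lemma smNl r x : sm (- r) x = - sm r x.
Proof. by apply: (addrI (sm r x)); rewrite -smDl !subrr sm0r. Qed.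
Lemma sm_sumr (T : Type) (s : seq T) P r (F : T -> M) :
  sm r (\sum_(i <- s | P i) F i) = \sum_(i <- s | P i) sm r (F i).
Proof. by apply: (big_morph _ (smDr r) (sm0 r)). Qed.
Lemma sm_suml (T : Type) (s : seq T) P (F : T -> R) x :
  sm (\sum_(i <- s | P i) F i) x = \sum_(i <- s | P i) sm (F i) x.
Proof. by apply: (big_morph (sm^~ x) (fun r s => smDl r s x) (sm0r x)). Qed.

Lemma adic0 I : adic I 0.
Proof. by exists [::]; rewrite big_nil. Qed.
Lemma adicD I x y : adic I x -> adic I y -> adic I (x + y).
Proof.
move=> [s [hs ->]] [t [ht ->]]; exists (s ++ t); split; last by rewrite big_cat.
by move=> p; rewrite mem_cat => /orP [/hs|/ht].
Qed.
Lemma adicN I x : adic I x -> adic I (- x).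
Proof.
move=> [s [hs ->]]; exists [seq (p.1, - p.2) | p <- s]; split.
  by move=> p /mapP [q qs ->] /=; apply: (hs q qs).
by rewrite big_map -sumrN; apply: eq_bigr => p _; rewrite smN.
Qed.
Lemma adicB I x y : adic I x -> adic I y -> adic I (x - y).
Proof. by move=> hx hy; apply: adicD => //; apply: adicN. Qed.
Lemma adic_subC I x y : adic I (x - y) -> adic I (y - x).
Proof. by move=> /adicN; rewrite opprB. Qed.
Lemma adic_trans I y x z : adic I (x - y) -> adic I (y - z) -> adic I (x - z).
Proof. by move=> h1 h2; rewrite -(addrNK y x) -addrA; apply: adicD. Qed.
Lemma adic_sum (T : eqType) (s : seq T) I (F : T -> M) :
  (forall i, i \in s -> adic I (F i)) -> adic I (\sum_(i <- s) F i).
Proof.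
move=> hF; rewrite big_seq; apply: (big_ind (adic I)) => //; first exact: adic0.
by move=> x y; apply: adicD.
Qed.
Lemma adicM (I : R -> Prop) r x : I r -> adic I (sm r x).
Proof.
move=> Ir; exists [:: (r, x)]; split; last by rewrite big_seq1.
by move=> p; rewrite inE => /eqP ->.
Qed.
Lemma adicZ I r x : is_ideal I -> adic I x -> adic I (sm r x).
Proof.
move=> hI [s [hs ->]]; rewrite sm_sumr; apply: adic_sum => p /hs Ip.
by rewrite -smA; apply: adicM; apply: idealMl.
Qed.
Lemma adic_sub (I J : R -> Prop) x : (forall r, I r -> J r) -> adic I x -> adic J x.
Proof. by move=> IJ [s [hs ->]]; exists s; split=> // p /hs /IJ. Qed.

Variable m : R -> Prop.
Hypothesis hm : is_ideal m.
Local Notation F n := (adic (ideal_pow m n)).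

Lemma adic_le i j x : (i <= j)%N -> F j x -> F i x.
Proof. by move=> le_ij; apply: adic_sub => r; apply: ideal_pow_le. Qed.
Lemma adic_pow0 x : F 0 x.
Proof. by rewrite -[x]sm1; apply: adicM. Qed.
Lemma adic_powM i j r x : ideal_pow m i r -> F j x -> F (i + j) (sm r x).
Proof.
move=> hr [s [hs ->]]; rewrite sm_sumr; apply: adic_sum => p /hs hp.
by rewrite -smA; apply: adicM; apply: ideal_powM.
Qed.
Lemma adic_pow1 x : adic m x <-> F 1 x.
Proof.
split; apply: adic_sub => r; last first.
  by apply: ideal_mul_ind => // u v mu _; apply: idealMr.
by move=> mr; rewrite -[r]mulr1; apply: ideal_mulM.
Qed.

Lemma adic_mul (I J : R -> Prop) x : is_ideal I -> adic (ideal_mul I J) x ->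
  exists s : seq (R * M), (forall p, p \in s -> I p.1 /\ adic J p.2) /\
    x = \sum_(p <- s) sm p.1 p.2.
Proof.
move=> hI [s [hs ->]]; elim: s hs => [|p s IH] hs.
  by exists [::]; rewrite !big_nil.
have [|t [ht e]] := IH; first by move=> q qs; apply: hs; rewrite inE qs orbT.
have [u [hu eu]] := hs p (mem_head _ _).
exists ([seq (q.1, sm q.2 p.2) | q <- u] ++ t); split.
  move=> q; rewrite mem_cat => /orP [/mapP [v vu ->]|/ht] //=.
  by have [? ?] := hu v vu; split=> //; apply: adicM.
rewrite big_cons e eu big_cat big_map sm_suml; congr (_ + _).
by apply: eq_bigr => q _; rewrite smA.
Qed.

(** The number of summands depends on [I] alone, so that a whole sequence of elements can be
    decomposed over one finite index set. *)
Lemma adic_mul_gen (s : seq R) (I J : R -> Prop) x :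
  (forall a, I a <-> ideal_gen s a) -> is_ideal I -> is_ideal J ->
  adic (ideal_mul I J) x ->
  exists w : 'I_(size s) -> M, (forall i, adic J (w i)) /\
    x = \sum_(i < size s) sm s`_i (w i).
Proof.
move=> hs hI hJ /(adic_mul hI) [t [ht ->]]; elim: t ht => [|p t IH] ht.
  exists (fun=> 0); split=> [i|]; first exact: adic0.
  by rewrite big_nil big1 // => i _; rewrite sm0.
have [|w [hw e]] := IH; first by move=> q qt; apply: ht; rewrite inE qt orbT.
have [/hs [c cE] hp] := ht p (mem_head _ _); rewrite big_cons e cE.
exists (fun i : 'I_(size s) => sm (c i) p.2 + w i); split=> [i|].
  by apply: adicD => //; apply: adicZ.
under [RHS]eq_bigr do rewrite smDr; rewrite big_split sm_suml.
by congr (_ + _); apply: eq_bigr => i _; rewrite mulrC smA.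
Qed.

(** Successive approximation: the remainder [r n] lies in the n-th step of the filtration, and the
    corrections [g n (r n)] sum to a solution. *)
Lemma adic_approx_surj (T : M -> M) : adic_complete m ->
  (forall x y, T (x + y) = T x + T y) -> (forall N x, F N x -> F N (T x)) ->
  (forall N x, F N x -> exists y, F N y /\ F N.+1 (x - T y)) ->
  forall x, exists y, T y = x.
Proof.
move=> [sepM cplM] TD TF step x.
have T0 : T 0 = 0 by apply: (addrI (T 0)); rewrite -TD !addr0.
have TB a b : T (a - b) = T a - T b.
  by apply: (addIr (T b)); rewrite -TD !subrK.
have [g hg] : exists g : nat -> M -> M, forall N z, F N z ->
    F N (g N z) /\ F N.+1 (z - T (g N z)).
  have [|g hg] := @choice (nat * M) M (fun p y => F p.1 p.2 ->
    F p.1 y /\ F p.1.+1 (p.2 - T y)); last by exists (fun N z => g (N, z)) => N z /(hg (N, z)).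
  move=> [N z] /=; have [/step [y hy]|nF] := EM (F N z); first by exists y.
  by exists 0.
pose r := fix r n := if n is k.+1 then r k - T (g k (r k)) else x.
have hr n : F n (r n).
  by elim: n => [|n IH]; [apply: adic_pow0 | apply: (hg n _ IH).2].
pose Y n := \sum_(k < n) g k (r k).
have xY n : x - T (Y n) = r n.
  elim: n => [|n IH]; first by rewrite /Y big_ord0 T0 subr0.
  by rewrite /Y big_ord_recr /= TD opprD addrA IH.
(* The shift by one makes the n-th increment the correction of index n+1, which has the order n+1
   that [adic_complete] asks for. *)
have [|y hy] := cplM (fun n => Y n.+1).
  by move=> n; rewrite /Y [X in X - _]big_ord_recr /= addrAC subrr add0r; exact: (hg n.+1 (r n.+1) (hr n.+1)).1.
exists y; apply/esym/eqP; rewrite -subr_eq0; apply/eqP/sepM => n.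
have -> : x - T y = r n.+1 - T (y - Y n.+1).
  by rewrite -xY TB opprB addrA subrK.
by apply: adicB => //; apply: TF.
Qed.

Hypotheses (noethR : noetherian R) (flatM : flat_action).

(** By flatness every relation over [M] comes from relations over [R]; as these form a finitely
    generated module, the generators [t] can be chosen before [x]. *)
Lemma flat_syzygy n (a : 'I_n -> R) :
  exists l (t : 'I_l -> 'I_n -> R), (forall q, \sum_j a j * t q j = 0) /\
    forall x : 'I_n -> M, \sum_j sm (a j) (x j) = 0 ->
      exists c : 'I_l -> M, forall j, x j = \sum_q sm (t q j) (c q).
Proof.
have [|||l [t [ht hg]]] := noetherian_fun_fg noethR (S := fun v => \sum_(j < n) a j * v j = 0).
- by rewrite big1 // => i _; rewrite mulr0.
- move=> u v hu hv; under eq_bigr do rewrite mulrDr.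
  by rewrite big_split /= hu hv addr0.
- move=> r u hu; under eq_bigr do rewrite mulrCA.
  by rewrite -mulr_sumr hu mulr0.
exists l, t; split=> // x /flatM [k [b [y [xE hb]]]].
have [c hc] : exists c : 'I_k -> 'I_l -> R, forall i j, b j i = \sum_q c i q * t q j.
  have [|c hc] := @choice _ _ (fun (i : 'I_k) (c : 'I_l -> R) =>
    forall j, b j i = \sum_q c q * t q j); last by exists c.
  by move=> i; apply: hg.
exists (fun q => \sum_(i < k) sm (c i q) (y i)) => j.
rewrite xE; under [RHS]eq_bigr do rewrite sm_sumr.
rewrite exchange_big /=; apply: eq_bigr => i _; rewrite hc sm_suml.
by apply: eq_bigr => q _; rewrite mulrC smA.
Qed.

(** [M0] is the Artin-Rees bound for the ideal [I] generated by the [a j]. Flatness transports the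
    ideal statement to [M]: in a trivializing matrix [b] of the relation, the part belonging to [a]
    may be replaced by coefficients [c] in m^N without changing its combination with [a]. *)
Lemma flat_artin_rees_row n (a : 'I_n -> R) N : exists M0, forall y : 'I_n -> M,
  F M0 (\sum_j sm (a j) (y j)) ->
  exists w : 'I_n -> M, (forall j, F N (w j)) /\
    \sum_j sm (a j) (w j) = \sum_j sm (a j) (y j).
Proof.
pose I x := exists c : 'I_n -> R, x = \sum_j a j * c j.
have hI : is_ideal I.
  split.
  - by exists (fun=> 0); rewrite big1 // => i _; rewrite mulr0.
  - move=> x y [c ->] [d ->]; exists (fun j => c j + d j).
    by rewrite -big_split; apply: eq_bigr => j _; rewrite mulrDr.
  - move=> r x [c ->]; exists (fun j => r * c j).
    by rewrite mulr_sumr; apply: eq_bigr => j _; rewrite mulrCA.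
have [M0 hM0] := artin_rees noethR N hm hI; exists M0 => y [s [hs ys]].
(* The equality of the combination with its small expression [s] is read as a single relation in n +
   size s terms. *)
pose r' (q : 'I_(n + size s)) := match fintype.split q with inl i => a i | inr l => - (nth (0, 0) s l).1 end.
pose x' (q : 'I_(n + size s)) := match fintype.split q with inl i => y i | inr l => (nth (0, 0) s l).2 end.
have r'l (i : 'I_n) : r' (lshift (size s) i) = a i.
  by rewrite /r' -[lshift _ _]/(unsplit (inl _)) unsplitK.
have r'r (i : 'I_(size s)) : r' (rshift n i) = - (nth (0, 0) s i).1.
  by rewrite /r' -[rshift _ _]/(unsplit (inr _)) unsplitK.
have x'l (i : 'I_n) : x' (lshift (size s) i) = y i.
  by rewrite /x' -[lshift _ _]/(unsplit (inl _)) unsplitK.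
have x'r (i : 'I_(size s)) : x' (rshift n i) = (nth (0, 0) s i).2.
  by rewrite /x' -[rshift _ _]/(unsplit (inr _)) unsplitK.
have [|k [b [z [xE hb]]]] := flatM (n := (n + size s)%N) (r := r') (x := x').
  rewrite big_split_ord /=; under eq_bigr do rewrite r'l x'l.
  under [X in _ + X]eq_bigr do rewrite r'r x'r smNl.
  by rewrite ys sumrN (big_nth (0, 0)) big_mkord subrr.
have [c hc] : exists c : 'I_k -> 'I_n -> R, forall q,
    (forall j, ideal_pow m N (c q j)) /\
    \sum_j a j * c q j = \sum_j a j * b (lshift _ j) q.
  have [|c hc] := @choice _ _ (fun (q : 'I_k) (c : 'I_n -> R) =>
    (forall j, ideal_pow m N (c j)) /\
    \sum_j a j * c j = \sum_j a j * b (lshift _ j) q); last by exists c.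
  move=> q; set u := \sum_j _.
  (* [u] is a combination of the [a j], and column [q] of the relation equates it with a combination
     of the scalars of [s], all in m^M0. *)
  have: ideal_mul (ideal_pow m N) I u.
    apply: hM0; first by exists (fun j => b (lshift _ j) q).
    have := hb q; rewrite big_split_ord /=.
    under eq_bigr do rewrite r'l.
    rewrite -/u => /eqP; rewrite addr_eq0 => /eqP ->.
    apply: idealN; first exact: is_ideal_pow.
    apply: ideal_sum => [|i _]; first exact: is_ideal_pow.
    rewrite r'r mulNr; apply: idealN; first exact: is_ideal_pow.
    by apply: idealMr; [apply: is_ideal_pow | apply: hs; apply: mem_nth].
  have hP := is_ideal_pow N hm.
  apply: (ideal_mul_ind (L := fun u => exists c : 'I_n -> R,
    (forall j, ideal_pow m N (c j)) /\ \sum_j a j * c j = u)).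
    split.
    - exists (fun=> 0); split=> [j|]; first exact: ideal0.
      by rewrite big1 // => j _; rewrite mulr0.
    - move=> v w [c [hc <-]] [d [hd <-]]; exists (fun j => c j + d j).
      split=> [j|]; first exact: idealD.
      by rewrite -big_split; apply: eq_bigr => j _; rewrite mulrDr.
    - move=> t v [c [hc <-]]; exists (fun j => t * c j).
      split=> [j|]; first exact: idealMl.
      by rewrite mulr_sumr; apply: eq_bigr => j _; rewrite mulrCA.
  move=> v w hv [c ->]; exists (fun j => v * c j); split=> [j|]; first exact: idealMr.
  by rewrite mulr_sumr; apply: eq_bigr => j _; rewrite mulrCA.
exists (fun j => \sum_q sm (c q j) (z q)); split=> [j|].
  by apply: adic_sum => q _; apply: adicM; case: (hc q).
transitivity (\sum_q sm (\sum_j a j * c q j) (z q)).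
  under eq_bigr do rewrite sm_sumr; rewrite exchange_big /=.
  by apply: eq_bigr => q _; rewrite sm_suml; apply: eq_bigr => j _; rewrite smA.
under eq_bigr => q do rewrite (hc q).2 sm_suml.
rewrite exchange_big; apply: eq_bigr => j _ /=.
by rewrite -x'l xE sm_sumr; apply: eq_bigr => q _; rewrite smA.
Qed.

(** Induction on the number of rows: once the first row has a small solution [b], the difference y -
    b is a combination of syzygies [t] of that row, and the other rows become a system in its
    coefficients. *)
Lemma flat_artin_rees k n (a : 'I_k -> 'I_n -> R) N : exists M0, forall y : 'I_n -> M,
  (forall i, F M0 (\sum_j sm (a i j) (y j))) ->
  exists w : 'I_n -> M, (forall j, F N (w j)) /\
    forall i, \sum_j sm (a i j) (w j) = \sum_j sm (a i j) (y j).
Proof.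
elim: k n a => [|k IH] n a.
  by exists 0%N => y _; exists (fun=> 0); split=> [j|[]//]; apply: adic0.
have [l [t [ht hsyz]]] := flat_syzygy (a ord0).
pose a' i j := a (lift ord0 i) j.
have [M1 hM1] := IH l (fun i q => \sum_j a' i j * t q j).
(* [b] has to be small to order [N] for the conclusion, and to order [M1] so that subtracting it
   keeps the remaining rows small enough for the induction. *)
have [M2 hM2] := flat_artin_rees_row (a ord0) (maxn M1 N).
exists (maxn M1 M2) => y hy.
have [|b [hb eb]] := hM2 y; first by apply: adic_le (hy ord0); apply: leq_maxr.
have [|c hc] := hsyz (fun j => y j - b j).
  by under eq_bigr do rewrite smB; rewrite sumrB eb subrr.
have tE i (d : 'I_l -> M) : \sum_q sm (\sum_j a i j * t q j) (d q) =
    \sum_j sm (a i j) (\sum_q sm (t q j) (d q)).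
  under eq_bigr do rewrite sm_suml; rewrite exchange_big /=.
  by apply: eq_bigr => j _; rewrite sm_sumr; apply: eq_bigr => q _; rewrite smA.
have [|d [hd ed]] := hM1 c.
  move=> i; rewrite tE; under eq_bigr do rewrite -hc smB; rewrite sumrB.
  apply: adicB; first by apply: adic_le (hy _); apply: leq_maxl.
  apply: adic_sum => j _; apply: adicZ; first exact: is_ideal_pow.
  by apply: adic_le (hb j); apply: leq_maxl.
exists (fun j => b j + \sum_q sm (t q j) (d q)); split=> [j|i].
  apply: adicD; first by apply: adic_le (hb j); apply: leq_maxr.
  by apply: adic_sum => q _; apply: adicZ => //; apply: is_ideal_pow.
under eq_bigr do rewrite smDr; rewrite big_split /= -tE.
case: (unliftP ord0 i) => [i' ->|->].
  rewrite ed tE -big_split; apply: eq_bigr => j _ /=.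
  by rewrite -hc -smDr addrC subrK.
by rewrite eb [X in _ + X]big1 ?addr0 // => q _; rewrite ht sm0r.
Qed.

End Modules.

(** The group is S modulo its intersection with Z. [cls] is total, with value 0 off [S]; its
    properties are therefore claimed on [S] only. *)
Lemma exists_subquotient (V : zmodType) (S Z : V -> Prop) :
  S 0 -> (forall u v, S u -> S v -> S (u - v)) ->
  Z 0 -> (forall u v, Z u -> Z v -> Z (u - v)) ->
  exists (P : zmodType) (cls : V -> P),
    [/\ forall p, exists u, S u /\ cls u = p,
        forall u v, S u -> S v -> cls (u + v) = cls u + cls v &
        forall u, S u -> (cls u = 0 <-> Z u)].
Proof.
move=> S0 SB Z0 ZB.
pose Sp : pred V := fun u => `[<S u>].
have Sp_closed : zmod_closed Sp.
  split; first exact/asboolP.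
  by move=> u v /asboolP Su /asboolP Sv; apply/asboolP/SB.
pose sT := {u : V | Sp u}.
pose sTz : zmodType := HB.pack sT (GRing.SubChoice_isSubZmodule.Build V Sp sT Sp_closed).
pose Zp : pred sTz := fun u => `[<Z (val (u : sT))>].
have Zp_closed : zmod_closed Zp.
  split; first exact/asboolP.
  by move=> u v /asboolP Su /asboolP Sv; apply/asboolP/ZB.
pose Zc : zmodClosed sTz := HB.pack Zp (GRing.isZmodClosed.Build sTz Zp Zp_closed).
pose inS (u : V) : sTz := insubd (0 : sTz) u.
have inSK u : S u -> val (inS u : sT) = u.
  by move=> Su; rewrite insubdK //; apply/asboolP.
pose pi (u : sTz) : (Quotient.quot Zc) := (\pi_(Quotient.quot Zc) u)%qT.
have piE u v : pi u = pi v <-> Z (val (u : sT) - val (v : sT)).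
  split; first by move/eqP; rewrite -Quotient.idealrBE => /asboolP.
  by move=> h; apply/eqP; rewrite -Quotient.idealrBE; apply/asboolP.
exists (Quotient.quot Zc), (fun u => pi (inS u)); split.
- move=> p; exists (val (repr p : sT)); split; first by case: (repr p : sT) => u /= /asboolP.
  by rewrite /inS valKd /pi reprK.
- move=> u v Su Sv; rewrite /pi -pi_addr; apply/piE.
  rewrite inSK; last by rewrite -[v]opprK; apply: (SB) => //; rewrite -[- v]sub0r; apply: (SB).
  by rewrite /= !inSK // subrr.
- move=> u Su; rewrite -[0](_ : pi 0 = 0); last by rewrite /pi pi_zeror.
  by rewrite piE inSK // subr0.
Qed.

(** * The completed localization as a right module *)

Definition eventually (P : nat -> Prop) := exists n0, forall n, (n0 <= n)%N -> P n.

Lemma eventually_and P Q : eventually P -> eventually Q -> eventually (fun n => P n /\ Q n).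
Proof.
move=> [i hi] [j hj]; exists (maxn i j) => n; rewrite geq_max => /andP [h1 h2].
by split; [apply: hi | apply: hj].
Qed.

Lemma eventually_impl (P Q : nat -> Prop) : (forall n, P n -> Q n) ->
  eventually P -> eventually Q.
Proof. by move=> PQ [i hi]; exists i => n /hi /PQ. Qed.

Lemma eventually_lt (P : nat -> nat -> Prop) N : (forall k, eventually (P k)) ->
  eventually (fun n => forall k, (k < N)%N -> P k n).
Proof.
move=> h; elim: N => [|N IH]; first by exists 0%N.
apply: eventually_impl (eventually_and (h N) IH) => n [hN hlt] k.
by rewrite ltnS leq_eqVlt => /orP [/eqP ->|/hlt].
Qed.

(* Choose for each [n] a witness that is good up to the largest possible
   level not exceeding [n]. *)
Lemma diagonal_choice (T : Type) (Q : nat -> nat -> T -> Prop) :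
  (forall n k t, Q n k.+1 t -> Q n k t) -> (forall n, exists t, Q n 0%N t) ->
  (forall k, eventually (fun n => exists t, Q n k t)) ->
  exists t : nat -> T, (forall n, Q n 0%N (t n)) /\
    forall k, eventually (fun n => Q n k (t n)).
Proof.
move=> Qdec Q0 Qev.
have Qle i j n t : (i <= j)%N -> Q n j t -> Q n i t.
  by move=> /subnK <-; elim: (j - i)%N => [|k IH] // /Qdec /IH.
have [|t ht] := @choice _ _ (fun n t => exists k, Q n k t /\
    forall j, (j <= n)%N -> (exists t, Q n j t) -> (j <= k)%N).
  move=> n; suff [k [hk [t ht]]] : exists k, (forall j, (j <= n)%N ->
      (exists t, Q n j t) -> (j <= k)%N) /\ exists t, Q n k t by exists t, k.
  elim: {1}n => [|N [k [hk ht]]].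
    by exists 0%N; split=> [j|]; [rewrite leqn0 => /eqP -> | apply: Q0].
  have [hN|hN] := EM (exists t, Q n N.+1 t).
    by exists N.+1.
  exists k; split=> // j; rewrite leq_eqVlt => /orP [/eqP -> //|].
  exact: hk.
exists t; split=> [n|k].
  by have [j [hj _]] := ht n; apply: Qle hj.
have [n0 hn0] := Qev k; exists (maxn n0 k) => n; rewrite geq_max => /andP [h1 h2].
by have [j [hj hmax]] := ht n; apply: Qle hj; apply: hmax => //; apply: hn0.
Qed.

Lemma inj_surj_bijective (S T : Type) (f : S -> T) :
  injective f -> (forall y, exists x, f x = y) -> bijective f.
Proof.
move=> f_inj f_surj; have [|g hg] := @choice _ _ (fun y x => f x = y) => //.
by exists g => x //; apply: f_inj.
Qed.

Definition right_module (A : pzRingType) (D : zmodType) (act : D -> A -> D) : Prop :=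
  [/\ forall x y a, act (x + y) a = act x a + act y a,
      forall x a b, act x (a + b) = act x a + act x b,
      forall x a b, act x (a * b) = act (act x a) b &
      forall x, act x 1 = x].

Definition restrict_scalars (R A : pzRingType) (iA : R -> A) (D : zmodType)
  (act : D -> A -> D) : R -> D -> D := fun r x => act x (iA r).

Section Algebra.
Variables (R : comPzRingType) (A : pzRingType) (iA : R -> A).
Hypotheses (homA : ring_hom iA) (centA : central_map iA).

Lemma is_module_algebra : is_module (fun r (a : A) => iA r * a).
Proof.
have [hD hM h1] := homA; split.
- by move=> r x y; rewrite mulrDr.
- by move=> r s x; rewrite hD mulrDl.
- by move=> r s x; rewrite hM mulrA.
- by move=> x; rewrite h1 mul1r.
Qed.

Lemma is_module_right (D : zmodType) (act : D -> A -> D) :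
  right_module act -> is_module (restrict_scalars iA act).
Proof.
have [hD hM h1] := homA; move=> [aDl aDr aM a1]; rewrite /restrict_scalars; split.
- by move=> r x y; rewrite aDl.
- by move=> r s x; rewrite hD aDr.
- by move=> r s x; rewrite mulrC hM aM.
- by move=> x; rewrite h1 a1.
Qed.

Section RightModule.
Variables (D : zmodType) (act : D -> A -> D).
Hypothesis actP : right_module act.

Lemma actDl x y a : act (x + y) a = act x a + act y a. Proof. by case: actP. Qed.
Lemma actDr x a b : act x (a + b) = act x a + act x b. Proof. by case: actP. Qed.
Lemma actA x a b : act x (a * b) = act (act x a) b. Proof. by case: actP. Qed.
Lemma act1 x : act x 1 = x. Proof. by case: actP. Qed.
Lemma act0 a : act 0 a = 0.
Proof. by apply: (addrI (act 0 a)); rewrite -actDl !addr0. Qed.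
Lemma actr0 x : act x 0 = 0.
Proof. by apply: (addrI (act x 0)); rewrite -actDr !addr0. Qed.
Lemma actNl x a : act (- x) a = - act x a.
Proof. by apply: (addrI (act x a)); rewrite -actDl !subrr act0. Qed.
Lemma actNr x a : act x (- a) = - act x a.
Proof. by apply: (addrI (act x a)); rewrite -actDr !subrr actr0. Qed.
Lemma actBl x y a : act (x - y) a = act x a - act y a.
Proof. by rewrite actDl actNl. Qed.
Lemma actBr x a b : act x (a - b) = act x a - act x b.
Proof. by rewrite actDr actNr. Qed.
Lemma act_sumr (T : Type) (s : seq T) P x (F : T -> A) :
  act x (\sum_(i <- s | P i) F i) = \sum_(i <- s | P i) act x (F i).
Proof. by apply: (big_morph _ (fun a b => actDr x a b) (actr0 x)). Qed.
Lemma act_suml (T : Type) (s : seq T) P a (F : T -> D) :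
  act (\sum_(i <- s | P i) F i) a = \sum_(i <- s | P i) act (F i) a.
Proof. by apply: (big_morph (act^~ a) (fun x y => actDl x y a) (act0 a)). Qed.

Local Notation FA I := (adic (fun r a => iA r * a) I).
Local Notation FD I := (adic (restrict_scalars iA act) I).

Lemma adic_act_ideal (I : R -> Prop) x a : FA I a -> FD I (act x a).
Proof.
move=> [s [hs ->]]; rewrite act_sumr; apply: adic_sum => p /hs Ip.
by rewrite centA actA; apply: adicM.
Qed.

Lemma adic_act (I : R -> Prop) x a : FD I x -> FD I (act x a).
Proof.
move=> [s [hs ->]]; rewrite act_suml; apply: adic_sum => p /hs Ip.
by rewrite /restrict_scalars -actA centA actA; apply: adicM.
Qed.

End RightModule.

Local Notation FA I := (adic (fun r a => iA r * a) I).

Lemma adic_mulr (I : R -> Prop) x a : FA I x -> FA I (x * a).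
Proof.
move=> [s [hs ->]]; rewrite mulr_suml; apply: adic_sum => p /hs Ip.
by rewrite -mulrA; apply: (adicM (fun r (a : A) => iA r * a)).
Qed.

Lemma adic_mull (I : R -> Prop) x a : FA I x -> FA I (a * x).
Proof.
move=> [s [hs ->]]; rewrite mulr_sumr; apply: adic_sum => p /hs Ip.
by rewrite mulrA -centA -mulrA; apply: (adicM (fun r (a : A) => iA r * a)).
Qed.

End Algebra.

(* The [R]-module [lim_N (colim (A/m^N --f--> A/m^N --f--> _))]: a sequence
   [u] with [u (n+1) - f u n -> 0] stands for the limit of [f^(-n) u n]. *)
Section CompletedLocalization.
Variables (R : comPzRingType) (m : R -> Prop) (A : pzRingType) (iA : R -> A) (f : A).
Hypotheses (noethR : noetherian R) (hm : is_ideal m).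
Hypotheses (homA : ring_hom iA) (centA : central_map iA) (flatA : flat_module iA).
Hypothesis commA : forall a b, ideal_submod iA m (a * b - b * a).

Let smA (r : R) (a : A) := iA r * a.
Let smAP : is_module smA := is_module_algebra homA.
Let flat_smA : flat_action smA := flatA.
Local Notation F n := (adic smA (ideal_pow m n)).

Definition null (u : nat -> A) := forall N, eventually (fun n => F N (u n)).
Definition regular (u : nat -> A) := null (fun n => u n.+1 - f * u n).

Lemma null0 : null (fun=> 0).
Proof. by move=> N; exists 0%N => n _; apply: adic0. Qed.
Lemma nullB u v : null u -> null v -> null (fun n => u n - v n).
Proof.
move=> hu hv N; apply: eventually_impl (eventually_and (hu N) (hv N)) => n [h1 h2].
exact: adicB.
Qed.
Lemma null_ext u v : eventually (fun n => u n = v n) -> null u -> null v.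
Proof.
by move=> e hu N; apply: eventually_impl (eventually_and (hu N) e) => n [h <-].
Qed.
Lemma null_mull u a : null u -> null (fun n => a * u n).
Proof.
by move=> hu N; apply: eventually_impl (hu N) => n; apply: (adic_mull centA).
Qed.
Lemma null_mulr u a : null u -> null (fun n => u n * a).
Proof.
by move=> hu N; apply: eventually_impl (hu N) => n; apply: (adic_mulr).
Qed.
Lemma null_shift u : null u -> null (fun n => u n.+1).
Proof.
by move=> hu N; have [n0 h] := hu N; exists n0 => n hn; apply: h; apply: leqW.
Qed.
Lemma regular0 : regular (fun=> 0).
Proof. by apply: null_ext null0; exists 0%N => n _; rewrite mulr0 subrr. Qed.
Lemma regularB u v : regular u -> regular v -> regular (fun n => u n - v n).
Proof.
move=> hu hv; apply: null_ext (nullB hu hv); exists 0%N => n _.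
by rewrite mulrBr !opprB addrACA [RHS]addrACA; congr (_ + _); rewrite addrC.
Qed.
Lemma regular_null u : null u -> regular u.
Proof. by move=> hu; apply: nullB; [apply: null_shift | apply: null_mull]. Qed.
Lemma regular_mulr u a : regular u -> regular (fun n => u n * a).
Proof.
move=> hu; apply: null_ext (null_mulr a hu); exists 0%N => n _.
by rewrite mulrBl mulrA.
Qed.

Lemma exists_sequence_quotient : exists (P : zmodType) (cls : (nat -> A) -> P),
  [/\ forall p, exists u, regular u /\ cls u = p,
      forall u v, regular u -> regular v -> cls (fun n => u n + v n) = cls u + cls v &
      forall u, regular u -> (cls u = 0 <-> null u)].
Proof.
exact: (exists_subquotient regular0 regularB null0 nullB).
Qed.

(** The Artin-Rees bound depends on the order [N] but not on the index [t]; taking at each [t] the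
    best order available makes the solutions tend to 0. *)
Lemma lift_null (k n : nat) (a : 'I_k -> 'I_n -> R) (y : nat -> 'I_n -> A) :
  (forall i, null (fun t => \sum_j smA (a i j) (y t j))) ->
  exists w : nat -> 'I_n -> A, (forall j, null (fun t => w t j)) /\
    forall t i, \sum_j smA (a i j) (w t j) = \sum_j smA (a i j) (y t j).
Proof.
move=> hy; have [||| w [w0 hw]] := diagonal_choice (Q := fun t N (w : 'I_n -> A) =>
  (forall j, F N (w j)) /\
  forall i, \sum_j smA (a i j) (w j) = \sum_j smA (a i j) (y t j)).
- by move=> t N w [h1 h2]; split=> // j; apply: adic_le (h1 j).
(* Order 0 demands no smallness, so [y t] itself serves; thus the equations hold at every index, not
   only eventually. *)
- by move=> t; exists (y t); split=> // j; apply: adic_pow0.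
- move=> N; have [M0 hM0] := flat_artin_rees smAP hm noethR flat_smA a N.
  have H : eventually (fun t => forall i, F M0 (\sum_j smA (a i j) (y t j))).
    have [g hg] := choice (fun i => hy i M0).
    exists (\max_i g i)%N => t ht i; apply: hg; apply: leq_trans ht.
    exact: (leq_bigmax i).
  by apply: eventually_impl H => t /hM0.
- exists w; split=> [j N|t i]; last by case: (w0 t).
  by apply: eventually_impl (hw N) => t [].
Qed.

(** The sequence v with initial term [v0] and defects v (n+1) - f v n = w n. Since scalars are
    central, an [R]-linear identity that holds for initial terms and defects propagates to all
    terms. *)
Fixpoint sequence_from (v0 : A) (w : nat -> A) n : A :=
  if n is k.+1 then f * sequence_from v0 w k + w k else v0.

Lemma regular_sequence_from v0 w : null w -> regular (sequence_from v0 w).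
Proof.
by apply: null_ext; exists 0%N => n _; rewrite /= addrC addKr.
Qed.

(** * The module of regular sequences modulo null sequences *)

Variables (P : zmodType) (cls : (nat -> A) -> P).
Hypotheses (cls_surj : forall p, exists u, regular u /\ cls u = p)
  (clsD : forall u v, regular u -> regular v -> cls (fun n => u n + v n) = cls u + cls v)
  (cls_eq0 : forall u, regular u -> (cls u = 0 <-> null u)).

Lemma regularN u : regular u -> regular (fun n => - u n).
Proof.
move=> hu; have := regularB regular0 hu; congr regular; apply: funext => n.
by rewrite sub0r.
Qed.

Lemma regularD u v : regular u -> regular v -> regular (fun n => u n + v n).
Proof.
move=> hu hv; have := regularB hu (regularN hv); congr regular; apply: funext => n.
by rewrite opprK.
Qed.

Lemma cls_null u : null u -> cls u = 0.
Proof. by move=> hu; apply/cls_eq0 => //; apply: regular_null. Qed.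

Lemma clsN u : regular u -> cls (fun n => - u n) = - cls u.
Proof.
move=> hu; apply: (addrI (cls u)); rewrite -clsD //; last exact: regularN.
rewrite subrr; apply: cls_null; apply: null_ext null0; exists 0%N => n _.
by rewrite subrr.
Qed.

Lemma clsB u v : regular u -> regular v -> cls (fun n => u n - v n) = cls u - cls v.
Proof. by move=> hu hv; rewrite -clsN // -clsD //; apply: regularN. Qed.

Lemma cls_eq u v : regular u -> regular v ->
  (cls u = cls v <-> null (fun n => u n - v n)).
Proof.
move=> hu hv; rewrite -cls_eq0; last exact: regularB.
rewrite clsB //; split=> [->|/eqP]; first by rewrite subrr.
by rewrite subr_eq0 => /eqP.
Qed.

Lemma regular_ext u v : eventually (fun n => u n = v n) -> regular u -> regular v.
Proof.
move=> e hu; apply: null_ext hu.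
have [n0 h] := e; exists n0 => n hn; rewrite (h n) // (h n.+1) //; exact: leqW.
Qed.

Lemma cls_ext u v : regular u -> eventually (fun n => u n = v n) -> cls u = cls v.
Proof.
move=> hu e; apply/cls_eq => //; first exact: regular_ext hu.
by apply: null_ext null0; apply: eventually_impl e => n ->; rewrite subrr.
Qed.

Lemma regular_sum (n : nat) (u : 'I_n -> nat -> A) : (forall i, regular (u i)) ->
  regular (fun t => \sum_i u i t).
Proof.
move=> hu; suff H (s : seq 'I_n) : regular (fun t => \sum_(i <- s) u i t) by apply: H.
elim: s => [|i s IH].
  by apply: regular_ext regular0; exists 0%N => t _; rewrite big_nil.
apply: regular_ext (regularD (hu i) IH); exists 0%N => t _; by rewrite big_cons.
Qed.

Lemma cls_sum (n : nat) (u : 'I_n -> nat -> A) : (forall i, regular (u i)) ->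
  cls (fun t => \sum_i u i t) = \sum_i cls (u i).
Proof.
move=> hu; suff H (s : seq 'I_n) : regular (fun t => \sum_(i <- s) u i t) /\
    cls (fun t => \sum_(i <- s) u i t) = \sum_(i <- s) cls (u i).
  by have [] := H (index_enum _).
elim: s => [|i s [IH1 IH2]].
  have e : (fun=> 0) = (fun t => \sum_(i <- [::]) u i t).
    by apply: funext => t; rewrite big_nil.
  by rewrite -e big_nil; split; [apply: regular0 | apply: cls_null; apply: null0].
have e : (fun t => u i t + \sum_(i <- s) u i t) = (fun t => \sum_(i <- i :: s) u i t).
  by apply: funext => t; rewrite big_cons.
by rewrite -e big_cons clsD // IH2; split=> //; apply: regularD.
Qed.

Definition rep (p : P) : nat -> A := sval (cid (cls_surj p)).
Lemma rep_regular p : regular (rep p).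
Proof. by rewrite /rep; case: cid => u []. Qed.
Lemma repK p : cls (rep p) = p.
Proof. by rewrite /rep; case: cid => u []. Qed.

(** Termwise multiplication on the right keeps sequences regular; on the left it would add the
    defect (a f - f a) u n, which need not tend to 0. *)
Definition act (p : P) (a : A) : P := cls (fun n => rep p n * a).
Local Notation smP := (restrict_scalars iA act).
Local Notation FP n := (adic smP (ideal_pow m n)).

Lemma act_cls u a : regular u -> act (cls u) a = cls (fun n => u n * a).
Proof.
move=> hu; apply/cls_eq; [apply: regular_mulr; exact: rep_regular|exact: regular_mulr|].
have /cls_eq : cls (rep (cls u)) = cls u by rewrite repK.
move=> /(_ (rep_regular _) hu) /(null_mulr a); congr null; apply: funext => n.
by rewrite mulrBl.
Qed.

Lemma act_right_module : right_module act.
Proof.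
split.
- move=> x y a; rewrite -[x]repK -[y]repK -clsD; try exact: rep_regular.
  rewrite !act_cls; try (try apply: regularD; exact: rep_regular).
  rewrite -clsD; try (apply: regular_mulr; exact: rep_regular).
  by congr cls; apply: funext => n; rewrite mulrDl.
- move=> x a b; rewrite /act -clsD; try (apply: regular_mulr; exact: rep_regular).
  by congr cls; apply: funext => n; rewrite mulrDr.
- move=> x a b; rewrite [act x a]/act act_cls; last by apply: regular_mulr; exact: rep_regular.
  by congr cls; apply: funext => n; rewrite mulrA.
- move=> x; rewrite -[RHS]repK; congr cls; apply: funext => n; exact: mulr1.
Qed.

Let smPP : is_module smP := is_module_right homA act_right_module.

Lemma smP_cls r u : regular u -> smP r (cls u) = cls (fun n => smA r (u n)).
Proof.
move=> hu; rewrite /restrict_scalars act_cls //; congr cls; apply: funext => n.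
by rewrite /smA centA.
Qed.

Lemma regular_sm r u : regular u -> regular (fun n => smA r (u n)).
Proof.
move=> /(regular_mulr (iA r)); congr regular; apply: funext => n.
by rewrite /smA centA.
Qed.

Lemma smP_sum_cls (n : nat) (r : 'I_n -> R) (u : 'I_n -> nat -> A) :
  (forall i, regular (u i)) ->
  \sum_i smP (r i) (cls (u i)) = cls (fun t => \sum_i smA (r i) (u i t)).
Proof.
move=> hu; rewrite cls_sum => [|i]; last exact: regular_sm.
by apply: eq_bigr => i _; rewrite smP_cls.
Qed.

(** The finite sum provides a representative with all its terms in m^N A, and [u] differs from it by
    a null sequence. *)
Lemma adic_cls_eventually N u : regular u -> FP N (cls u) ->
  eventually (fun n => F N (u n)).
Proof.
move=> hu [s [hs e]].
have [v [hv ev hF]] : exists v, [/\ regular v, cls v = \sum_(p <- s) smP p.1 p.2 &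
    forall n, F N (v n)].
  elim: s hs {e} => [|p s IH] hs.
    exists (fun=> 0); rewrite big_nil; split; [exact: regular0 | | by move=> n; apply: adic0].
    by apply: cls_null; apply: null0.
  have [|v [hv ev hF]] := IH; first by move=> q qs; apply: hs; rewrite inE qs orbT.
  have hp : regular (fun n => smA p.1 (rep p.2 n)) by apply: regular_sm; exact: rep_regular.
  exists (fun n => smA p.1 (rep p.2 n) + v n); split.
  - exact: regularD.
  - by rewrite clsD // ev -smP_cls ?repK ?big_cons //; apply: rep_regular.
  - by move=> n; apply: adicD => //; apply: adicM; apply: hs; apply: mem_head.
have /cls_eq : cls u = cls v by rewrite ev.
move=> /(_ hu hv) /(_ N); apply: eventually_impl => n h.
by rewrite -(subrK (v n) (u n)); apply: adicD.
Qed.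

(** After zeroing the first terms, the initial term and all defects are expanded in fixed generators
    of m^N. A defect in m^(N+k) A has coefficients in m^k A, so the coefficients of the defects can
    be chosen null, and [sequence_from] turns them into regular coefficient sequences. *)
Lemma eventually_adic_cls N u : regular u -> eventually (fun n => F N (u n)) ->
  FP N (cls u).
Proof.
move=> hu [n0 hF]; pose v n := if (n < n0)%N then 0 else u n.
have uv : eventually (fun n => u n = v n).
  by exists n0 => n; rewrite /v ltnNge => ->.
rewrite (cls_ext hu uv); have hv : regular v by apply: regular_ext hu.
have {}hF n : F N (v n).
  by rewrite /v; case: ltnP => [_|/hF]; first exact: adic0.
have [s hs] := noethR (is_ideal_pow N hm).
have split_F k x : F (N + k) x -> exists w : 'I_(size s) -> A,
    (forall i, F k (w i)) /\ x = \sum_(i < size s) smA s`_i (w i).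
  move=> h; apply: (adic_mul_gen smAP hs); [exact: is_ideal_pow|exact: is_ideal_pow|].
  by apply: adic_sub h => r; apply: ideal_powD.
have [|||w [w0 hw]] := diagonal_choice (Q := fun n k (w : 'I_(size s) -> A) =>
  (forall i, F k (w i)) /\ v n.+1 - f * v n = \sum_(i < size s) smA s`_i (w i)).
- by move=> n k w [h1 h2]; split=> // i; apply: adic_le (h1 i).
- move=> n; apply: split_F; rewrite addn0; apply: adicB => //.
  by apply: (adic_mull centA).
- by move=> k; apply: eventually_impl (hv (N + k)%N) => n /split_F.
have [|y0 [_ hy0]] := @split_F 0%N (v 0%N); first by rewrite addn0.
pose y i := sequence_from (y0 i) (fun n => w n i).
have hy i : regular (y i).
  apply: regular_sequence_from => k.
  by apply: eventually_impl (hw k) => n [].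
have vE n : v n = \sum_(i < size s) smA s`_i (y i n).
  elim: n => [|n IH] //=.
  have := (w0 n).2 => /eqP; rewrite subr_eq => /eqP ->.
  rewrite IH mulr_sumr addrC -big_split; apply: eq_bigr => i _ /=.
  by rewrite /smA mulrDr mulrA -centA -mulrA.
have -> : v = (fun n => \sum_(i < size s) smA s`_i (y i n)) by apply: funext.
rewrite -(smP_sum_cls (fun i : 'I_(size s) => s`_i)) //; apply: adic_sum => i _.
by apply: adicM; apply/hs/ideal_gen_nth.
Qed.

Lemma adic_rep N p : FP N p <-> eventually (fun n => F N (rep p n)).
Proof.
have h := rep_regular p; rewrite -{1}[p]repK.
by split; [apply: adic_cls_eventually | apply: eventually_adic_cls].
Qed.

Lemma act_separated p : (forall n, FP n.+1 p) -> p = 0.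
Proof.
move=> hp; rewrite -[p]repK; apply: cls_null => N.
apply/adic_rep; apply: adic_le (hp N) => //; exact: leqnSn.
Qed.

(** The limit is a diagonal sequence u (K n) n, where [K] tends to infinity slowly enough that at
    index n the first [K n] congruences between representatives already hold. *)
Lemma act_complete : adic_complete smP m.
Proof.
split=> [|p hp]; first exact: act_separated.
pose u k := rep (p k); have hu k : regular (u k) by apply: rep_regular.
have hd k : eventually (fun n => F k.+1 (u k.+1 n - u k n)).
  apply: adic_cls_eventually; first exact: regularB.
  by rewrite clsB // !repK.
have [||| K [_ hK]] := diagonal_choice (Q := fun n N K => (N <= K)%N /\
  forall k, (k < K)%N -> F k.+1 (u k.+1 n - u k n)).
- by move=> n k K [h1 h2]; split=> //; apply: ltnW.
- by move=> n; exists 0%N.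
- by move=> k; apply: eventually_impl (eventually_lt k hd) => n h; exists k.
have tele n N K0 : (N <= K0)%N ->
    (forall k, (k < K0)%N -> F k.+1 (u k.+1 n - u k n)) -> F N.+1 (u K0 n - u N n).
  move=> leNK; elim: K0 leNK => [|K0 IH].
    by rewrite leqn0 => /eqP -> _; rewrite subrr; apply: adic0.
  rewrite leq_eqVlt => /orP [/eqP -> _|]; first by rewrite subrr; apply: adic0.
  rewrite ltnS => leNK h; apply: (adic_trans (y := u K0 n)).
    by apply: adic_le (h K0 _) => //; rewrite ltnS.
  by apply: IH => // k hk; apply: h; apply: leqW.
pose v n := u (K n) n.
have vu N : eventually (fun n => F N.+1 (v n - u N n)).
  by apply: eventually_impl (hK N) => n [h1 h2]; apply: tele.
have hv : regular v.
  move=> N; have vu' : eventually (fun n => F N.+1 (v n.+1 - u N n.+1)).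
    by have [n0 h] := vu N; exists n0 => n hn; apply: h; apply: leqW.
  have := eventually_and (vu N) (eventually_and vu' (hu N N)).
  apply: eventually_impl => n [h1 [h2 h3]].
  apply: (adic_trans (y := u N n.+1)); first by apply: adic_le h2.
  apply: (adic_trans h3); rewrite -mulrBr; apply: (adic_mull centA).
  by apply: adic_subC => //; apply: adic_le h1.
exists (cls v) => N; have -> : cls v - p N = cls (fun n => v n - u N n).
  by rewrite clsB // repK.
by apply: eventually_adic_cls (vu N); apply: regularB.
Qed.

(** A null correction [c] makes the relation exact at every index. The initial terms and the defects
    of the corrected representatives are then relations themselves, hence combinations of the
    finitely many syzygies [a] of [r]; their coefficients assemble to the elements [y]. *)
Lemma act_flat : flat_action smP.
Proof.
move=> n r x hx; pose u i := rep (x i).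
have hu i : regular (u i) by apply: rep_regular.
have hz : null (fun t => \sum_i smA (r i) (u i t)).
  apply/cls_eq0; first by apply: regular_sum => i; apply: regular_sm.
  by rewrite -smP_sum_cls // -[RHS]hx; apply: eq_bigr => i _; rewrite repK.
have [|c [hc ec]] := @lift_null 1 n (fun _ => r) (fun t i => u i t); first by [].
pose v i t := u i t - c t i.
have hv i : regular (v i) by apply: regularB => //; apply: regular_null.
have xv i : x i = cls (v i).
  by rewrite /v clsB //; [rewrite (cls_null (hc i)) subr0 repK | apply: regular_null].
have v_rel t : \sum_i smA (r i) (v i t) = 0.
  under eq_bigr do rewrite smB //.
  by rewrite sumrB (ec t ord0) subrr.
have [l [a [ha hsyz]]] := flat_syzygy smAP noethR flat_smA r.
have [e he] : exists e : nat -> 'I_l -> A, forall t i,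
    v i t.+1 - f * v i t = \sum_q smA (a q i) (e t q).
  have [|e he] := @choice _ _ (fun t (e : 'I_l -> A) => forall i,
    v i t.+1 - f * v i t = \sum_q smA (a q i) (e q)); last by exists e.
  move=> t; apply: hsyz; under eq_bigr do rewrite smB //.
  rewrite sumrB v_rel sub0r; apply/eqP; rewrite oppr_eq0; apply/eqP.
  under eq_bigr do rewrite /smA mulrA centA -mulrA.
  by rewrite -mulr_sumr v_rel mulr0.
(* The defects tend to 0 but their coefficients [e] need not; [w] gives the same combinations with
   null coefficients. *)
have [|w [hw ew]] := @lift_null n l (fun i q => a q i) e.
  by move=> i; have := hv i; congr null; apply: funext => t; rewrite he.
have [y0 hy0] := hsyz _ (v_rel 0%N).
pose y q := sequence_from (y0 q) (fun t => w t q).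
have hy q : regular (y q) by apply: regular_sequence_from.
have vE i t : v i t = \sum_q smA (a q i) (y q t).
  elim: t => [|t IH] //=.
  have /eqP := he t i; rewrite subr_eq => /eqP ->.
  rewrite IH mulr_sumr -ew addrC -big_split; apply: eq_bigr => q _ /=.
  by rewrite /smA mulrDr mulrA -centA -mulrA.
exists l, (fun i q => a q i), (fun q => cls (y q)); split=> [i|//].
by rewrite smP_sum_cls // xv; congr cls; apply: funext => t.
Qed.

(** * Bijectivity of the right action of [f] *)

Lemma adic_comm N a : F N a -> F N.+1 (a * f - f * a).
Proof.
move=> [s [hs ->]]; rewrite mulr_suml mulr_sumr -sumrB.
apply: (adic_sum (sm := smA)) => p /hs hp.
rewrite mulrA -centA -!mulrA -mulrBr -addn1.
have h1 : F 1 (p.2 * f - f * p.2) by apply/(adic_pow1 smA hm); apply: commA.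
exact: (adic_powM smAP hm hp h1).
Qed.

(** If u n f is null, then u (n+1) is close to f u n, hence to f u n - u n f, a commutator of order
    one higher than u n; so the order of u n is eventually above any bound. *)
Lemma act_f_inj : injective (act^~ f).
Proof.
suff H p : act p f = 0 -> p = 0.
  move=> x y e; apply/eqP; rewrite -subr_eq0; apply/eqP; apply: H.
  by rewrite (actBl act_right_module) e subrr.
have hu := rep_regular p => h; rewrite -[p]repK; apply: cls_null.
have {}h : null (fun n => rep p n * f) by apply/cls_eq0 => //; apply: regular_mulr.
elim=> [|N IH]; first by exists 0%N => n _; apply: adic_pow0.
have [n0 hn0] : eventually (fun n => F N.+1 (rep p n.+1)).
  have := eventually_and IH (eventually_and (h N.+1) (hu N.+1)).
  apply: eventually_impl => n [h1 [h2 h3]].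
  rewrite -(subrK (f * rep p n) (rep p n.+1)); apply: adicD => //.
  by rewrite -(subKr (rep p n * f) (f * rep p n)); apply: adicB => //; apply: adic_comm.
by exists n0.+1 => -[|n] // hn; apply: hn0.
Qed.

(* [f] acts on the right as [f - [f, -]] acts on the left, and the left action
   is invertible by shifting sequences: a solution of [y f = x] is corrected
   modulo higher and higher powers of [m]. *)
Lemma act_f_step N p : FP N p -> exists q, FP N q /\ FP N.+1 (p - act q f).
Proof.
move=> /adic_rep hp; have hu := rep_regular p.
(* The shift inverts left multiplication by [f]: f v (n+1) = f u n is u (n+1) up to a defect. The
   repeated value at index 0 does not affect the class. *)
pose v n := rep p n.-1.
have hv : regular v.
  by move=> k; have [n0 h] := hu k; exists n0.+1 => -[|n] // hn; apply: h.
exists (cls v); split.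
  apply: eventually_adic_cls => //.
  by have [n0 h] := hp; exists n0.+1 => -[|n] // hn; apply: h.
rewrite act_cls // -{1}[p]repK -clsB //; last exact: regular_mulr.
apply: eventually_adic_cls; first by apply: regularB => //; apply: regular_mulr.
have [n0 h0] := eventually_and hp (hu N.+1).
exists n0.+1 => -[|n] // hn; have [h1 h2] := h0 n hn.
apply: (adic_trans h2); rewrite /v /=.
by apply: adic_subC => //; apply: adic_comm.
Qed.

Lemma act_f_bij : bijective (act^~ f).
Proof.
apply: inj_surj_bijective; first exact: act_f_inj.
have actP := act_right_module.
apply: (adic_approx_surj smPP act_complete (T := act^~ f)).
- by move=> x y; rewrite (actDl actP).
- by move=> N x; apply: (adic_act centA actP).
- exact: act_f_step.
Qed.

(** The limit of f^(-n) f^n, that is, the future unit. *)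
Definition act_one : P := cls (fun n => f ^+ n).

Lemma regular_exp : regular (fun n => f ^+ n).
Proof. by apply: null_ext null0; exists 0%N => n _; rewrite exprS subrr. Qed.

(** From an index [k] on, all defects of [p] lie in m^N A, so that u n is congruent to f^(n-k) u k.
    Here [y] is the class of f^(n-k), which stands for f^(-k), and [a] is u k. *)
Lemma act_dense p N : exists k y a, act y (f ^+ k) = act_one /\ FP N (p - act y a).
Proof.
have hu := rep_regular p; have [k hk] := hu N.
have rf b : regular (fun n => f ^+ (n - k) * b).
  by apply: null_ext null0; exists k => n hn; rewrite subSn // exprS mulrA subrr.
have rf1 : regular (fun n => f ^+ (n - k)).
  by have := rf 1; congr regular; apply: funext => n; rewrite mulr1.
exists k, (cls (fun n => f ^+ (n - k))), (rep p k); split.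
  rewrite act_cls //; apply: cls_ext => //.
  by exists k => n hn; rewrite -exprD subnK.
rewrite act_cls // -{1}[p]repK -clsB //.
apply: eventually_adic_cls; first exact: regularB.
exists k => n /subnK <-; elim: (n - k)%N => [|j IH].
  by rewrite subnn mul1r subrr; apply: adic0.
have := hk (j + k)%N (leq_addl _ _); rewrite addSn => h.
rewrite addnK in IH *; rewrite -addSn addnK exprS -mulrA.
by apply: (adic_trans h); rewrite -mulrBr; apply: (adic_mull centA).
Qed.

(** * Linear maps from the completed localization *)

Section Extension.
Variables (D : zmodType) (actD : D -> A -> D).
Hypotheses (actDP : right_module actD) (bijD : bijective (actD^~ f)).
Hypothesis cplD : adic_complete (restrict_scalars iA actD) m.
Local Notation FD n := (adic (restrict_scalars iA actD) (ideal_pow m n)).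
Let smDP := is_module_right homA actDP.

(** [phi] sends the class of u to the limit of x0 f^(-n) u n. Consecutive terms differ by y (n+1)
    applied to the defect u (n+1) - f u n, so the sequence is Cauchy. *)
Lemma act_extension x0 : exists phi : P -> D,
  [/\ forall p q, phi (p + q) = phi p + phi q,
      forall p a, phi (act p a) = actD (phi p) a & phi act_one = x0].
Proof.
have [finv finvK fK] := bijD; have [sepD limD] := cplD.
pose y n := iter n finv x0.
have yf n : actD (y n.+1) f = y n by apply: fK.
pose is_lim u x := forall N, eventually (fun n => FD N (x - actD (y n) (u n))).
have lim_uniq u x x' : is_lim u x -> is_lim u x' -> x = x'.
  move=> h h'; apply/eqP; rewrite -subr_eq0; apply/eqP/sepD => N.
  have [n0 hn] := eventually_and (h N.+1) (h' N.+1).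
  have [h1 h2] := hn n0 (leqnn _).
  by apply: (adic_trans h1); apply: adic_subC.
have lim_ext u v x : null (fun n => u n - v n) -> is_lim u x -> is_lim v x.
  move=> uv h N; apply: eventually_impl (eventually_and (h N) (uv N)) => n [h1 h2].
  by apply: (adic_trans h1); rewrite -(actBr actDP); apply: (adic_act_ideal centA).
have lim_ex u : regular u -> exists x, is_lim u x.
  move=> hu; have [g hg] := choice (fun k => hu k.+1).
  (* The thresholds [g k] need not increase with [k]; their partial sums do and still dominate
     them. *)
  pose c k := (\sum_(j < k.+1) g j)%N.
  have cS k : (c k <= c k.+1)%N by rewrite /c [X in (_ <= X)%N]big_ord_recr leq_addr.
  have gc k : (g k <= c k)%N by rewrite /c big_ord_recr leq_addl.
  have near k n : (c k <= n)%N -> FD k.+1 (actD (y n) (u n) - actD (y (c k)) (u (c k))).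
    move=> /subnK <-; elim: (n - c k)%N => [|j IH]; first by rewrite subrr; apply: adic0.
    apply: adic_trans IH; rewrite addSn -(yf (j + c k)%N) -(actA actDP) -(actBr actDP).
    apply: (adic_act_ideal centA) => //; apply: hg.
    by apply: leq_trans (gc k) _; apply: leq_addl.
  have [|x hx] := limD (fun k => actD (y (c k)) (u (c k))).
    by move=> k; apply: near.
  exists x => N; exists (c N) => n /near h.
  apply: (adic_le (m := m) hm (leqnSn N)); apply: (adic_trans (hx N)).
  exact: adic_subC.
have [phi hphi] : exists phi : P -> D, forall p, is_lim (rep p) (phi p).
  by have [phi h] := choice (fun p => lim_ex _ (rep_regular p)); exists phi.
have phi_cls u x : regular u -> is_lim u x -> phi (cls u) = x.
  move=> hu hx; apply: (lim_uniq u) => //; apply: lim_ext (hphi (cls u)).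
  by apply/cls_eq; rewrite ?repK //; apply: rep_regular.
exists phi; split.
- move=> p q; rewrite -{1}[p]repK -{1}[q]repK -clsD; try exact: rep_regular.
  apply: phi_cls; first by apply: regularD; apply: rep_regular.
  move=> N; apply: eventually_impl (eventually_and (hphi p N) (hphi q N)) => n [h1 h2].
  by rewrite (actDr actDP) opprD addrACA; apply: adicD.
- move=> p a; apply: phi_cls; first by apply: regular_mulr; apply: rep_regular.
  move=> N; apply: eventually_impl (hphi p N) => n h.
  by rewrite (actA actDP) -(actBl actDP); apply: (adic_act centA).
- apply: phi_cls; first exact: regular_exp.
  move=> N; exists 0%N => n _; suff -> : actD (y n) (f ^+ n) = x0 by rewrite subrr; apply: adic0.
  by elim: n => [|n IH]; [apply: (act1 actDP) | rewrite exprS (actA actDP) yf].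
Qed.

End Extension.

End CompletedLocalization.

(** * The ring structure and its universal property *)

Section CompletedLocalizationRing.
Variables (R : comPzRingType) (m : R -> Prop) (A : pzRingType) (iA : R -> A) (f : A).

(** The equation for [y] says that it is f^(-k); in this form it makes sense before there is a
    product on [P]. *)
Definition dense_fractions (P : zmodType) (act : P -> A -> P) (one : P) : Prop :=
  forall p N, exists k y a, act y (f ^+ k) = one /\
    adic (restrict_scalars iA act) (ideal_pow m N) (p - act y a).

(** Targets are modules rather than rings, so that the property also yields the product of [P]
    itself and, through a twisted action on a product of modules, derivations. *)
Definition extends_linearly (P : zmodType) (act : P -> A -> P) (one : P) : Prop :=
  forall (D : zmodType) (actD : D -> A -> D), right_module actD ->
    bijective (actD^~ f) -> adic_complete (restrict_scalars iA actD) m ->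
    forall x0, exists phi : P -> D,
      [/\ forall p q, phi (p + q) = phi p + phi q,
          forall p a, phi (act p a) = actD (phi p) a & phi one = x0].

Definition completed_localization (A' : pzRingType) (g : A -> A') : Prop :=
  [/\ ring_hom g /\ central_map (fun r => g (iA r)),
      flat_module (fun r => g (iA r)), madic_complete m (fun r => g (iA r)),
      exists e, e * g f = 1 /\ g f * e = 1 &
      dense_fractions (fun x a => x * g a) 1 /\
      extends_linearly (fun x a => x * g a) 1].

Hypotheses (homA : ring_hom iA) (centA : central_map iA) (hm : is_ideal m).

(** [phi] vanishes at f^(-k) by injectivity of [f] on [D], hence on all fractions; being linear it
    respects the filtrations, and density with separatedness gives 0. *)
Lemma dense_fractions_linear0 (P : zmodType) (act : P -> A -> P) (one : P)
    (D : zmodType) (actD : D -> A -> D) (phi : P -> D) :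
  dense_fractions act one -> right_module actD -> injective (actD^~ f) ->
  (forall x, (forall n, adic (restrict_scalars iA actD) (ideal_pow m n.+1) x) -> x = 0) ->
  (forall p q, phi (p + q) = phi p + phi q) ->
  (forall p a, phi (act p a) = actD (phi p) a) -> phi one = 0 ->
  forall p, phi p = 0.
Proof.
move=> dense actDP injf sepD phiD phiA phi1 p; apply: sepD => n.
have [k [y [a [y1 h]]]] := dense p n.+1.
have phi0 : phi 0 = 0 by apply: (addrI (phi 0)); rewrite -phiD !addr0.
have y0 : phi y = 0.
  move: phi1; rewrite -y1 phiA; elim: k {y1} => [|k IH]; first by rewrite expr0 (act1 actDP).
  by rewrite exprSr (actA actDP) -[0 in X in X -> _](act0 actDP f) => /injf.
have -> : phi p = phi (p - act y a).
  by rewrite -{1}(subrK (act y a) p) phiD phiA y0 (act0 actDP) addr0.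
case: h => s [hs ->]; rewrite (big_morph phi phiD phi0).
apply: adic_sum => q /hs hq; rewrite /restrict_scalars phiA.
by apply: (adicM (restrict_scalars iA actD)).
Qed.

Lemma dense_fractions_linear_uniq (P : zmodType) (act : P -> A -> P) (one : P)
    (D : zmodType) (actD : D -> A -> D) (phi psi : P -> D) :
  dense_fractions act one -> right_module actD -> injective (actD^~ f) ->
  (forall x, (forall n, adic (restrict_scalars iA actD) (ideal_pow m n.+1) x) -> x = 0) ->
  (forall p q, phi (p + q) = phi p + phi q) ->
  (forall p a, phi (act p a) = actD (phi p) a) ->
  (forall p q, psi (p + q) = psi p + psi q) ->
  (forall p a, psi (act p a) = actD (psi p) a) ->
  phi one = psi one -> forall p, phi p = psi p.
Proof.
move=> dense actDP injf sepD phiD phiA psiD psiA e p.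
apply/eqP; rewrite -subr_eq0; apply/eqP.
apply: (dense_fractions_linear0 (phi := fun p => phi p - psi p) dense actDP injf) => //.
- by move=> x y; rewrite phiD psiD opprD addrACA.
- by move=> x a; rewrite phiA psiA (actBl actDP).
- by rewrite e subrr.
Qed.

Lemma completed_localization_ring (P : zmodType) (act : P -> A -> P) (one : P) :
  right_module act -> adic_complete (restrict_scalars iA act) m ->
  flat_action (restrict_scalars iA act) -> bijective (act^~ f) ->
  dense_fractions act one -> extends_linearly act one ->
  exists (A' : pzRingType) (g : A -> A'), completed_localization g.
Proof.
(* Exposing the carrier and its class lets the ring built below have definitionally the additive
   group of [P]. *)
case: P act one => T cT; pose P : zmodType := GRing.Zmodule.Pack cT.
rewrite -/P => act one actP cplP flatP bijP dense ext.
have injP : injective (act^~ f) by apply: bij_inj.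
have [mul hmul] := choice (ext P act actP bijP cplP).
have mulDr x y z : mul x (y + z) = mul x y + mul x z by case: (hmul x).
have mulact x y a : mul x (act y a) = act (mul x y) a by case: (hmul x).
have mulx1 x : mul x one = x by case: (hmul x).
have uniq phi psi : (forall p q : P, phi (p + q) = phi p + phi q) ->
    (forall p a, phi (act p a) = act (phi p) a) ->
    (forall p q, psi (p + q) = psi p + psi q) ->
    (forall p a, psi (act p a) = act (psi p) a) ->
    phi one = psi one -> forall p, phi p = psi p.
  by apply: dense_fractions_linear_uniq => //; case: cplP.
have mulA : associative mul.
  move=> x y; apply: (uniq (fun z => mul x (mul y z)) (mul (mul x y))) => //.
  - by move=> p q; rewrite !mulDr.
  - by move=> p a; rewrite !mulact.
  - by rewrite !mulx1.
have mul1x : left_id one mul by apply: (uniq (mul one) id) => //; rewrite mulx1.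
have mulDl : left_distributive mul +%R.
  move=> x y; apply: (uniq (mul (x + y)) (fun z => mul x z + mul y z)) => //.
  - by move=> p q; rewrite !mulDr addrACA.
  - by move=> p a; rewrite !mulact (actDl actP).
  - by rewrite !mulx1.
pose A' : pzRingType := HB.pack T cT
  (GRing.Zmodule_isPzRing.Build P mulA mul1x mulx1 mulDl mulDr).
pose g (a : A) : A' := act one a.
have mulg (x : A') a : x * g a = act x a.
  by change (mul x (act one a) = act x a); rewrite mulact mulx1.
have actE : (fun (x : A') a => x * g a) = act by apply: funext => x; apply: funext => a.
have gM a b : g (a * b) = g a * g b by rewrite mulg /g (actA actP).
have central : central_map (fun r => g (iA r)).
  move=> r x; rewrite mulg.
  apply: (uniq (mul (g (iA r))) (fun x => act x (iA r)) (mulDr _) (mulact _)).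
  - by move=> p q; rewrite (actDl actP).
  - by move=> p a; rewrite -!(actA actP) centA.
  - exact: mulx1.
have smE : (fun r (x : A') => g (iA r) * x) = restrict_scalars iA act.
  by apply: funext => r; apply: funext => x; rewrite central mulg.
exists A', g; split.
- split=> //; split=> //; last exact: (act1 actP).
  by move=> a b; rewrite /g (actDr actP).
- by rewrite /flat_module -/(flat_action (fun r (x : A') => g (iA r) * x)) smE.
- rewrite /madic_complete -/(adic_complete (fun r (x : A') => g (iA r) * x) m).
  by rewrite smE.
- have [finv _ fK] := bijP; exists (finv one : A').
  have e1 : (finv one : A') * g f = 1 by rewrite mulg; apply: fK.
  (* The left inverse is also a right inverse: (f e) f = f (e f) = f, and right multiplication by
     [f] is injective. *)
  split=> //; apply: injP; change (act (g f * finv one : A') f = act one f).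
  by rewrite -mulg -mulrA e1 mulr1.
- by rewrite actE.
Qed.

Lemma exists_completed_localization :
  noetherian R -> flat_module iA ->
  (forall a b, ideal_submod iA m (a * b - b * a)) ->
  exists (A' : pzRingType) (g : A -> A'), completed_localization g.
Proof.
move=> noethR flatA commA.
have [P [cls [surj clsD cls0]]] := exists_sequence_quotient m f homA.
apply: (@completed_localization_ring P (act surj) (act_one f cls)).
- exact: act_right_module.
- exact: act_complete.
- exact: act_flat.
- exact: act_f_bij.
- by move=> p N; apply: act_dense.
- by move=> D actD h1 h2 h3 x0; apply: act_extension.
Qed.

(** * Ring-theoretic consequences of the universal property *)

Section Localization.
Variables (A' : pzRingType) (g : A -> A').
Hypothesis locg : completed_localization g.

Let iA' r := g (iA r).

Lemma loc_hom : ring_hom g. Proof. by case: locg => [[]]. Qed.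
Lemma loc_iA_hom : ring_hom iA'.
Proof.
have [hD hM h1] := homA; have [gD gM g1] := loc_hom; rewrite /iA'; split.
- by move=> x y; rewrite hD gD.
- by move=> x y; rewrite hM gM.
- by rewrite h1 g1.
Qed.
Lemma loc_central : central_map iA'. Proof. by case: locg => [[]]. Qed.
Lemma loc_flat : flat_module iA'. Proof. by case: locg. Qed.
Lemma loc_complete : madic_complete m iA'. Proof. by case: locg. Qed.
Lemma loc_unit : exists e, e * g f = 1 /\ g f * e = 1. Proof. by case: locg. Qed.

Lemma right_module_hom (B : pzRingType) (h : A -> B) : ring_hom h ->
  right_module (fun x a => x * h a).
Proof.
move=> [hD hM h1]; split.
- by move=> x y a; rewrite mulrDl.
- by move=> x a b; rewrite hD mulrDr.
- by move=> x a b; rewrite hM mulrA.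
- by move=> x; rewrite h1 mulr1.
Qed.

Lemma restrict_scalars_hom (B : pzRingType) (h : A -> B) :
  central_map (fun r => h (iA r)) ->
  restrict_scalars iA (fun x a => x * h a) = (fun r x => h (iA r) * x).
Proof.
by move=> cent; apply: funext => r; apply: funext => x; rewrite cent.
Qed.

Lemma unit_mulr_bij (B : pzRingType) (h : A -> B) :
  (exists e, e * h f = 1 /\ h f * e = 1) -> bijective (fun x => x * h f).
Proof.
move=> [e [e1 e2]]; exists (fun x => x * e) => x.
  by rewrite -mulrA e2 mulr1.
by rewrite -mulrA e1 mulr1.
Qed.

Lemma loc_linear_uniq (D : zmodType) (actD : D -> A -> D) (phi psi : A' -> D) :
  right_module actD -> injective (actD^~ f) ->
  (forall x, (forall n, adic (restrict_scalars iA actD) (ideal_pow m n.+1) x) -> x = 0) ->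
  (forall p q, phi (p + q) = phi p + phi q) ->
  (forall p a, phi (p * g a) = actD (phi p) a) ->
  (forall p q, psi (p + q) = psi p + psi q) ->
  (forall p a, psi (p * g a) = actD (psi p) a) ->
  phi 1 = psi 1 -> forall p, phi p = psi p.
Proof.
by case: locg => _ _ _ _ [dense _]; apply: (dense_fractions_linear_uniq dense).
Qed.

Section RingTarget.
Variables (B : pzRingType) (h : A -> B).
Hypotheses (homh : ring_hom h) (centh : central_map (fun r => h (iA r))).
Hypotheses (cplB : madic_complete m (fun r => h (iA r)))
  (unith : exists e, e * h f = 1 /\ h f * e = 1).

Let actB (x : B) a := x * h a.
Let actBP : right_module actB := right_module_hom homh.
Let injB : injective (actB^~ f) := bij_inj (unit_mulr_bij unith).
Let cplB' : adic_complete (restrict_scalars iA actB) m.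
Proof. by rewrite /actB restrict_scalars_hom. Qed.

(** [B] is a right [A]-module through [h]. For fixed x, both g' (x y) and g' x g' y are linear in y
    and agree at y = 1, which gives multiplicativity. *)
Lemma loc_extension : exists2 g' : A' -> B, ring_hom g' & forall a, h a = g' (g a).
Proof.
have [_ _ _ _ [_ ext]] := locg; have [gD gM g1] := loc_hom.
have [g' [g'D g'A g'1]] := ext B actB actBP (unit_mulr_bij unith) cplB' 1.
exists g'; last by move=> a; rewrite -[g a]mul1r g'A g'1 /actB mul1r.
split=> // x; apply: (loc_linear_uniq actBP injB (proj1 cplB')).
- by move=> p q; rewrite mulrDr g'D.
- by move=> p a; rewrite mulrA g'A.
- by move=> p q; rewrite g'D mulrDr.
- by move=> p a; rewrite g'A /actB mulrA.
- by rewrite mulr1 g'1 mulr1.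
Qed.

Lemma loc_extension_uniq (g1 g2 : A' -> B) : ring_hom g1 -> ring_hom g2 ->
  (forall a, h a = g1 (g a)) -> (forall a, h a = g2 (g a)) -> forall x, g1 x = g2 x.
Proof.
move=> [D1 M1 I1] [D2 M2 I2] h1 h2.
apply: (loc_linear_uniq actBP injB (proj1 cplB')) => //.
- by move=> p a; rewrite M1 -h1.
- by move=> p a; rewrite M2 -h2.
- by rewrite I1 I2.
Qed.

End RingTarget.

Let actA' (x : A') a := x * g a.
Let actA'P : right_module actA' := right_module_hom loc_hom.
Let injA' : injective (actA'^~ f) := bij_inj (unit_mulr_bij loc_unit).
Let cplA' : adic_complete (restrict_scalars iA actA') m.
Proof. by rewrite /actA' restrict_scalars_hom; [apply: loc_complete | apply: loc_central]. Qed.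

(** Two rounds of uniqueness: commutation with the image of [A] comes first, because it is what
    makes x |-> x y linear for general y. *)
Lemma loc_commutative : commutative (@GRing.mul A) -> commutative (@GRing.mul A').
Proof.
have [gD gM g1] := loc_hom.
have uniq := loc_linear_uniq actA'P injA' (proj1 cplA').
move=> AC; have gC a x : x * g a = g a * x.
  move: x; apply: (uniq (fun x => x * g a) (fun x => g a * x)).
  - by move=> p q; rewrite mulrDl.
  - by move=> p b; rewrite /actA' -!mulrA -!gM AC.
  - by move=> p q; rewrite mulrDr.
  - by move=> p b; rewrite /actA' mulrA.
  - by rewrite mul1r mulr1.
move=> x y; move: x; apply: (uniq (fun x => x * y) (fun x => y * x)).
- by move=> p q; rewrite mulrDl.
- by move=> p b; rewrite /actA' -!mulrA gC.
- by move=> p q; rewrite mulrDr.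
- by move=> p b; rewrite /actA' mulrA.
- by rewrite mul1r mulr1.
Qed.

Lemma loc_dense x N : exists y a, [/\ exists k, y * g f ^+ k = 1 &
  ideal_submod iA' (ideal_pow m N) (x - y * g a)].
Proof.
have [_ _ _ _ [dense _]] := locg; have [k [y [a [y1 h]]]] := dense x N.
have [gD gM g1] := loc_hom.
have gX j : g (f ^+ j) = g f ^+ j.
  by elim: j => [|j IH]; rewrite ?expr0 // !exprS gM IH.
exists y, a; split; first by exists k; rewrite -gX.
by move: h; rewrite restrict_scalars_hom //; exact: loc_central.
Qed.

End Localization.
End CompletedLocalizationRing.

(** * Localization of associative deformations *)

Lemma ring_hom0 (S T : pzRingType) (h : S -> T) : ring_hom h -> h 0 = 0.
Proof. by move=> [hD _ _]; apply: (addrI (h 0)); rewrite -hD !addr0. Qed.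
Lemma ring_homN (S T : pzRingType) (h : S -> T) x : ring_hom h -> h (- x) = - h x.
Proof.
by move=> hh; apply: (addrI (h x)); case: (hh) => hD _ _; rewrite -hD !subrr ring_hom0.
Qed.
Lemma ring_homB (S T : pzRingType) (h : S -> T) x y : ring_hom h -> h (x - y) = h x - h y.
Proof. by move=> hh; rewrite -ring_homN //; case: hh. Qed.
Lemma ring_homX (S T : pzRingType) (h : S -> T) x n : ring_hom h -> h (x ^+ n) = h x ^+ n.
Proof.
by move=> [_ hM h1]; elim: n => [|n IH]; rewrite ?expr0 // !exprS hM IH.
Qed.
Lemma ring_hom_comp (S T U : pzRingType) (h : S -> T) (k : T -> U) :
  ring_hom h -> ring_hom k -> ring_hom (fun x => k (h x)).
Proof.
move=> [hD hM h1] [kD kM k1]; split.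
- by move=> x y; rewrite hD kD.
- by move=> x y; rewrite hM kM.
- by rewrite h1 k1.
Qed.
Lemma ring_hom_submod (R : comPzRingType) (S T : pzRingType) (iS : R -> S) (h : S -> T)
    (I : R -> Prop) x :
  ring_hom h -> ideal_submod iS I x -> ideal_submod (fun r => h (iS r)) I (h x).
Proof.
move=> hh [t [ht ->]]; have [hD hM _] := hh.
rewrite (big_morph h hD (ring_hom0 hh)); apply: (adic_sum (sm := fun r (b : T) => h (iS r) * b)).
move=> p /ht hp; rewrite hM.
by apply: (adicM (fun r (b : T) => h (iS r) * b)).
Qed.

Lemma expr_inverse (S : pzRingType) (x e : S) k : e * x = 1 -> e ^+ k * x ^+ k = 1.
Proof.
move=> h; elim: k => [|k IH]; first by rewrite !expr0 mulr1.
by rewrite exprSr exprS mulrA -(mulrA _ e) h mulr1.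
Qed.

Section Deformation.
Variables (K : fieldType) (R : comPzRingType) (iR : K -> R) (m : R -> Prop).
Hypothesis hR : parameter_algebra iR m.

Lemma parameter_ideal : is_ideal m. Proof. by case: hR => _ [[]]. Qed.
Lemma parameter_noetherian : noetherian R. Proof. by case: hR. Qed.
Local Notation hm := parameter_ideal.

(** A lift [y] of [c] inverts [x] on both sides modulo m A, and completeness refines it to a left
    inverse and a right inverse, which then coincide. *)
Lemma deformation_unit (C : comPzRingType) (iC : K -> C) (A : pzRingType)
    (iA : R -> A) (pi : A -> C) x c :
  assoc_deformation iR m iC iA pi -> pi x * c = 1 ->
  exists e, e * x = 1 /\ x * e = 1.
Proof.
move=> [[homA centA] _ cplA [[hpi _] surj] ker] xc.
have [piD piM pi1] := hpi; have [y yc] := surj c.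
have smP := is_module_algebra homA.
have step1 z : ideal_submod iA m z -> adic (fun r a => iA r * a) (ideal_pow m 1) z.
  by move=> hz; apply/(adic_pow1 _ hm).
have err z : pi z = 1 -> ideal_submod iA m (1 - z).
  by move=> hz; apply/ker; rewrite ring_homB // pi1 hz subrr.
have errM N z w : adic (fun r a => iA r * a) (ideal_pow m N) z -> ideal_submod iA m w ->
    adic (fun r a => iA r * a) (ideal_pow m N.+1) (z * w) /\
    adic (fun r a => iA r * a) (ideal_pow m N.+1) (w * z).
  move=> [s [hs ->]] /step1 hw; rewrite -addn1; split.
    rewrite mulr_suml; apply: adic_sum => p /hs hp; rewrite -mulrA.
    apply: (adic_powM smP hm hp).
    by apply: (adic_mull centA).
  rewrite mulr_sumr; apply: adic_sum => p /hs hp.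
  rewrite mulrA -centA -mulrA; apply: (adic_powM smP hm hp).
  by apply: adic_mulr.
have [e he] : exists e, e * x = 1.
  apply: (adic_approx_surj smP (T := fun z => z * x) cplA).
  - by move=> u v; rewrite mulrDl.
  - by move=> N z; apply: adic_mulr.
  - move=> N z hz; exists (z * y); split; first exact: adic_mulr.
    rewrite -mulrA -{1}[z]mulr1 -mulrBr; apply: (errM N _ _ hz _).1.
    by apply: err; rewrite piM yc mulrC.
have [e' he'] : exists e, x * e = 1.
  apply: (adic_approx_surj smP (T := fun z => x * z) cplA).
  - by move=> u v; rewrite mulrDr.
  - by move=> N z; apply: (adic_mull centA).
  - move=> N z hz; exists (y * z); split; first exact: (adic_mull centA).
    rewrite mulrA -{1}[z]mul1r -mulrBl; apply: (errM N _ _ hz _).2.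
    by apply: err; rewrite piM yc.
by exists e; split=> //; rewrite -{1}(mulr1 e) -he' (mulrA e) he mul1r.
Qed.

Variables (C C' : comPzRingType) (iC : K -> C) (iC' : K -> C') (tau : C -> C').
Hypothesis htau : kalg_hom iC iC' tau.
Variable s : C.
Hypotheses (s_unit : exists u : C', tau s * u = 1)
  (s_frac : forall c' : C', exists (c : C) (n : nat), c' * tau s ^+ n = tau c)
  (s_ker : forall c : C, tau c = 0 -> exists n : nat, s ^+ n * c = 0).

Variables (A : pzRingType) (iA : R -> A) (pi : A -> C).
Hypothesis defA : assoc_deformation iR m iC iA pi.

Lemma deformation_hom : ring_hom iA. Proof. by case: defA => [[]]. Qed.
Lemma deformation_central : central_map iA. Proof. by case: defA => [[]]. Qed.
Lemma deformation_aug : ring_hom pi. Proof. by case: defA => _ _ _ [[]]. Qed.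

Lemma deformation_comm a b : ideal_submod iA m (a * b - b * a).
Proof.
have [_ _ _ _ ker] := defA; have piH := deformation_aug; have [_ piM _] := piH.
by apply/ker; rewrite ring_homB // !piM mulrC subrr.
Qed.

Variable f : A.
Hypothesis pi_f : pi f = s.

Lemma exists_deformation_localization :
  exists (A' : pzRingType) (g : A -> A'), completed_localization m iA f g.
Proof.
apply: exists_completed_localization.
- exact: deformation_hom.
- exact: deformation_central.
- exact: hm.
- exact: parameter_noetherian.
- by case: defA.
- exact: deformation_comm.
Qed.

Variables (A' : pzRingType) (g : A -> A').
Hypothesis locg : completed_localization m iA f g.

(** [C'] is itself a target for the universal property: m acts on it by 0, so its filtration is
    trivial and compatible families are constant. The condition on the kernel of [tau] enters only
    in identifying the kernel of [pi']. *)
Lemma localization_augmentation : exists pi' : A' -> C',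
  assoc_deformation iR m iC' (fun r => g (iA r)) pi' /\ forall a, pi' (g a) = tau (pi a).
Proof.
have [[homA centA] flatA cplA [[piH piK] surj] ker] := defA.
have [tauH tauK] := htau; have hH := ring_hom_comp piH tauH.
have m0 r : m r -> tau (pi (iA r)) = 0.
  move=> mr; suff -> : pi (iA r) = 0 by apply: ring_hom0.
  by apply/ker; rewrite -[iA r]mulr1; exact: (adicM (fun r (a : A) => iA r * a) 1 mr).
have sub0 x : ideal_submod (fun r => tau (pi (iA r))) m x -> x = 0.
  by move=> [t [ht ->]]; rewrite big_seq big1 // => p /ht /m0 ->; rewrite mul0r.
have sub0n n x : ideal_submod (fun r => tau (pi (iA r))) (ideal_pow m n.+1) x -> x = 0.
  move=> h; apply: sub0; move: h; apply: (@adic_sub R C' (fun r c => tau (pi (iA r)) * c)) => r.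
  by apply: ideal_mul_ind => [|u v mu _]; [exact: hm | exact: (idealMr _ hm)].
have [|||pi' pi'H pi'g] := loc_extension locg hH.
- by move=> r x; rewrite mulrC.
- split=> [x h|a ha]; first exact: (sub0n 0%N).
  exists (a 0%N) => n; suff -> : a 0%N = a n by rewrite subrr; apply: (@adic0 R C' (fun r c => tau (pi (iA r)) * c)).
  elim: n => [|n ->] //; apply/esym/eqP; rewrite -subr_eq0; apply/eqP.
  exact: (sub0n n).
- by have [u hu] := s_unit; exists u; rewrite pi_f mulrC.
exists pi'; split; last by move=> a; rewrite pi'g.
have [pi'D pi'M pi'1] := pi'H.
have [e [e1 e2]] := loc_unit locg; have gH := loc_hom locg; have [gD gM g1] := gH.
have smP := is_module_algebra (loc_iA_hom homA locg).
have cent := loc_central locg.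
have kill x : ideal_submod (fun r => g (iA r)) m x -> pi' x = 0.
  move=> /(ring_hom_submod pi'H) h; apply: sub0; move: h.
  by congr ideal_submod; apply: funext => r; rewrite -pi'g.
split.
- by split; [exact: (loc_iA_hom homA locg) | exact: cent].
- exact: loc_flat locg.
- exact: loc_complete locg.
- split; first by split=> // k; rewrite -pi'g piK tauK.
  move=> c'; have [c [n hc]] := s_frac c'; have [a ha] := surj c.
  exists (g a * e ^+ n); rewrite pi'M -pi'g ha -hc -pi_f pi'g -mulrA.
  by rewrite -ring_homX // -pi'M -[X in pi' X](_ : 1 = _) ?pi'1 ?mulr1 // expr_inverse.
- move=> x; split; last exact: kill.
  (* Modulo m A' the element is a fraction f^(-k) a with tau (pi a) = 0. Some s^n kills pi a, so f^n
     a is in m A, and inverting f^n places g a in m A'. *)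
  move=> x0; have [y [a [[k y1] hx]]] := loc_dense locg x 1.
  have {}hx := (adic_pow1 (fun r (b : A') => g (iA r) * b) hm _).2 hx.
  have ya0 : pi' y * tau (pi a) = 0.
    by have := kill _ hx; rewrite ring_homB // x0 sub0r pi'M -pi'g => /eqP; rewrite oppr_eq0 => /eqP.
  have ta0 : tau (pi a) = 0.
    by rewrite -[LHS]mul1r -pi'1 -y1 pi'M mulrAC ya0 mul0r.
  have [n hn] := s_ker ta0.
  have : ideal_submod iA m (f ^+ n * a).
    by apply/ker; have [_ piM _] := piH; rewrite piM ring_homX // pi_f.
  move=> /(ring_hom_submod gH) h.
  rewrite -(subrK (y * g a) x); apply: (@adicD R A' (fun r b => g (iA r) * b)); first exact: hx.
  apply: (adic_mull cent).
  rewrite -[g a]mul1r -(expr_inverse n e1) -mulrA -ring_homX // -gM.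
  exact: (adic_mull cent).
Qed.

Section Universal.
Variables (C'' : comPzRingType) (iC'' : K -> C'') (tau' : C' -> C'').
Variables (A'' : pzRingType) (iA'' : R -> A'') (pi'' : A'' -> C'') (h : A -> A'').
Hypotheses (htau' : kalg_hom iC' iC'' tau') (defA'' : assoc_deformation iR m iC'' iA'' pi'')
  (hh : ralg_hom iA iA'' h) (hpi : forall a, pi'' (h a) = tau' (tau (pi a))).

Lemma localization_target : [/\ ring_hom h, central_map (fun r => h (iA r)),
  madic_complete m (fun r => h (iA r)) & exists e, e * h f = 1 /\ h f * e = 1].
Proof.
have [hH hi] := hh; have [[tau'D tau'M tau'1] _] := htau'.
have E : (fun r => h (iA r)) = iA'' by apply: funext.
rewrite E; have [[_ cent] _ cpl _ _] := defA''; split=> //.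
have [u hu] := s_unit.
apply: (deformation_unit (c := tau' u) defA'').
by rewrite hpi pi_f -tau'M hu tau'1.
Qed.

Lemma localization_universal : exists! g' : A' -> A'',
  ralg_hom (fun r => g (iA r)) iA'' g' /\ forall a, h a = g' (g a).
Proof.
have [hH cent cpl unit] := localization_target.
have [g' g'H g'g] := loc_extension locg hH cent cpl unit.
exists g'; split.
  by split=> //; split=> // r; rewrite -g'g; case: hh.
move=> g2 [[g2H _] g2g]; apply: funext => x.
exact: (loc_extension_uniq locg hH cent cpl unit).
Qed.

End Universal.
End Deformation.

(** * Derivations and Poisson brackets *)

Section Product.
Variables (R : comPzRingType) (M N : zmodType) (sM : R -> M -> M) (sN : R -> N -> N).
Hypotheses (sMP : is_module sM) (sNP : is_module sN).
Let sMN r (p : M * N) := (sM r p.1, sN r p.2).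

Lemma adic_pair (I : R -> Prop) p : adic sMN I p <-> adic sM I p.1 /\ adic sN I p.2.
Proof.
split=> [[s [hs ->]]|].
  rewrite (big_morph (@fst M N) (id1 := 0) (op1 := +%R)) //.
  rewrite (big_morph (@snd M N) (id1 := 0) (op1 := +%R)) //.
  split; apply: adic_sum => q /hs hq; exact: adicM.
case: p => x y [[s [hs /= ->]] [t [ht /= ->]]].
exists ([seq (q.1, (q.2, 0)) | q <- s] ++ [seq (q.1, (0, q.2)) | q <- t]); split.
  by move=> q; rewrite mem_cat => /orP [] /mapP [q' h ->]; [apply: (hs q') | apply: (ht q')].
rewrite big_cat !big_map /=; apply: injective_projections => /=.
  rewrite !(big_morph (@fst M N) (id1 := 0) (op1 := +%R)) //=.
  by rewrite [X in _ + X]big1 ?addr0 // => q _; rewrite (sm0 sMP).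
rewrite !(big_morph (@snd M N) (id1 := 0) (op1 := +%R)) //=.
by rewrite [X in X + _]big1 ?add0r // => q _; rewrite (sm0 sNP).
Qed.

(** Serves for the module A' x A' that encodes derivations. *)
Lemma adic_complete_pair (m : R -> Prop) :
  adic_complete sM m -> adic_complete sN m -> adic_complete sMN m.
Proof.
move=> [sepM cM] [sepN cN]; split.
  move=> [x y] h; congr pair; [apply: sepM | apply: sepN] => n;
  by have /adic_pair [] := h n.
move=> a ha; have [|x hx] := cM (fun n => (a n).1).
  by move=> n; have /adic_pair [] := ha n.
have [|y hy] := cN (fun n => (a n).2).
  by move=> n; have /adic_pair [] := ha n.
by exists (x, y) => n; apply/adic_pair.
Qed.

End Product.

Section Derivations.
Variables (R : comPzRingType) (m : R -> Prop) (A : comPzRingType) (iA : R -> A) (f : A).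
Hypotheses (hm : is_ideal m) (homA : ring_hom iA).
Variables (A' : comPzRingType) (g : A -> A').
Hypothesis locg : completed_localization m iA f g.

Let gH : ring_hom g := loc_hom locg.
Let gD x y : g (x + y) = g x + g y. Proof. by case: gH. Qed.
Let gM x y : g (x * y) = g x * g y. Proof. by case: gH. Qed.
Let g1 : g 1 = 1. Proof. by case: gH. Qed.
Let smA' := is_module_algebra (loc_iA_hom homA locg).

Definition derivation (E : A' -> A') : Prop :=
  (forall x y, E (x + y) = E x + E y) /\ (forall x y, E (x * y) = E x * y + x * E y).

Lemma derivation1 E : derivation E -> E 1 = 0.
Proof.
move=> [_ EM]; apply: (addrI (E 1)); rewrite addr0.
by have := EM 1 1; rewrite !mulr1 mul1r => <-.
Qed.

(** A derivation along [g'] that vanishes on the image of [A] is [A]-linear, and its value at 1 is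
    0. *)
Lemma derivation_along_uniq (B : comPzRingType) (g' : A' -> B) (E : A' -> B) :
  ring_hom g' ->
  (forall x, (forall n, ideal_submod (fun r => g' (g (iA r))) (ideal_pow m n.+1) x) -> x = 0) ->
  (forall x y, E (x + y) = E x + E y) ->
  (forall x y, E (x * y) = E x * g' y + g' x * E y) ->
  (forall a, E (g a) = 0) -> forall x, E x = 0.
Proof.
move=> g'H sepB ED EM Eg x; have [_ g'M g'1] := g'H.
have hH := ring_hom_comp gH g'H.
have hf : exists e, e * g' (g f) = 1 /\ g' (g f) * e = 1.
  have [e [e1 e2]] := loc_unit locg; exists (g' e).
  by rewrite -!g'M e1 e2 g'1.
apply: (loc_linear_uniq locg (psi := fun=> 0) (right_module_hom hH)
  (bij_inj (unit_mulr_bij hf))) => //.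
- by rewrite restrict_scalars_hom // => r y; rewrite mulrC.
- by move=> p a; rewrite EM Eg mulr0 addr0.
- by move=> p q; rewrite addr0.
- by move=> p a; rewrite mul0r.
- by rewrite -g1 Eg.
Qed.

Lemma derivation_uniq E : derivation E -> (forall a, E (g a) = 0) -> forall x, E x = 0.
Proof.
move=> [ED EM]; apply: (@derivation_along_uniq A' id E) => //.
by case: (loc_complete locg).
Qed.

Lemma derivation_eq E1 E2 : derivation E1 -> derivation E2 ->
  (forall a, E1 (g a) = E2 (g a)) -> forall x, E1 x = E2 x.
Proof.
move=> [D1 M1] [D2 M2] e x; apply/eqP; rewrite -subr_eq0; apply/eqP.
apply: (derivation_uniq (E := fun x => E1 x - E2 x)); last by move=> a; rewrite e subrr.
split=> y z; first by rewrite D1 D2; ring.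
by rewrite M1 M2; ring.
Qed.

(* [x |-> (x, D x)] is the [A]-linear extension of [1 |-> (1, 0)] to the
   [A]-module [A' x A'] with action [(x, y) b = (x b, y b + x delta b)]. *)
Lemma derivation_extension (delta : A -> A') :
  (forall a b, delta (a + b) = delta a + delta b) ->
  (forall a b, delta (a * b) = delta a * g b + g a * delta b) ->
  (forall r, delta (iA r) = 0) ->
  exists E, derivation E /\ forall a, E (g a) = delta a.
Proof.
move=> dD dM dR.
have d1 : delta 1 = 0 by have [_ _ <-] := homA.
pose act (p : A' * A') a : A' * A' := (p.1 * g a, p.2 * g a + p.1 * delta a).
have actP : right_module act.
  split.
  - by move=> [x y] [z t] a; congr pair => /=; ring.
  - by move=> [x y] a b; congr pair; rewrite /= ?gD ?dD; ring.
  - by move=> [x y] a b; congr pair; rewrite /= ?gM ?dM; ring.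
  - by move=> [x y]; rewrite /act /= g1 d1 mulr0 addr0 !mulr1.
have [e [e1 e2]] := loc_unit locg.
have bij : bijective (act^~ f).
  exists (fun p => (p.1 * e, (p.2 - p.1 * e * delta f) * e)) => -[x y]; congr pair => /=.
  - by rewrite -mulrA e2 mulr1.
  - by rewrite -[x * g f * e]mulrA e2 mulr1 addrK -mulrA e2 mulr1.
  - by rewrite -mulrA e1 mulr1.
  - by rewrite -[_ * e * g f]mulrA e1 mulr1 subrK.
have cpl : adic_complete (restrict_scalars iA act) m.
  (* As [delta] kills scalars, the twist disappears for them, and completeness is that of the plain
     product. *)
  have -> : restrict_scalars iA act = (fun r p => (g (iA r) * p.1, g (iA r) * p.2)).
    apply: funext => r; apply: funext => p.
    by rewrite /restrict_scalars /act dR mulr0 addr0 !(mulrC (g _)).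
  have cA : adic_complete (fun r (b : A') => g (iA r) * b) m by exact: (loc_complete locg).
  exact: (adic_complete_pair smA' smA' cA cA).
have [_ _ _ _ [_ ext]] := locg.
have [phi [phiD phiA phi1]] := ext _ act actP bij cpl (1, 0).
have fst_phi x : (phi x).1 = x.
  have [e_unit sepA'] := (loc_unit locg, proj1 (loc_complete locg)).
  apply: (loc_linear_uniq locg (phi := fun x => (phi x).1) (psi := id)
    (right_module_hom gH) (bij_inj (unit_mulr_bij e_unit))) => //.
  - by rewrite restrict_scalars_hom //; apply: loc_central locg.
  - by move=> p q; rewrite phiD.
  - by move=> p a; rewrite phiA.
  - by rewrite phi1.
pose E x := (phi x).2.
have ED x y : E (x + y) = E x + E y by rewrite /E phiD.
have EA x a : E (x * g a) = E x * g a + x * delta a.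
  by rewrite /E phiA /= fst_phi.
have E1 : E 1 = 0 by rewrite /E phi1.
exists E; split; last by move=> a; rewrite -[g a]mul1r EA E1 mul0r add0r mul1r.
split=> // x y; apply/eqP; rewrite -subr_eq0; apply/eqP.
have [e_unit sepA'] := (loc_unit locg, proj1 (loc_complete locg)).
(* For fixed [x] the defect of the Leibniz rule is linear in y: the terms with [delta] cancel by
   [EA]. *)
apply: (loc_linear_uniq locg (phi := fun y => E (x * y) - (E x * y + x * E y))
  (psi := fun=> 0) (right_module_hom gH) (bij_inj (unit_mulr_bij e_unit))) => //.
- by rewrite restrict_scalars_hom //; apply: loc_central locg.
- by move=> p q; rewrite mulrDr !ED; ring.
- by move=> p a; rewrite mulrA !EA; ring.
- by move=> p q; rewrite addr0.
- by move=> p a; rewrite mul0r.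
- by rewrite E1 !mulr1 mulr0 addr0 subrr.
Qed.

Local Notation F I := (ideal_submod (fun r => g (iA r)) I).

(** [E] preserves m A' because it kills scalars, so fractions suffice; for y = f^(-k) the quotient
    rule E y = - y^2 E (f^k) applies. *)
Lemma derivation_sub_ideal (E : A' -> A') : derivation E ->
  (forall r, E (g (iA r)) = 0) -> (forall a, F m (E (g a))) -> forall x, F m (E x).
Proof.
move=> hE Er Eg x; have [ED EM] := hE.
have [y [a [[k yk] hx]]] := loc_dense locg x 1.
have {}hx := (adic_pow1 (fun r (b : A') => g (iA r) * b) hm _).2 hx.
have E0 : E 0 = 0 by apply: (addrI (E 0)); rewrite -ED !addr0.
have Fm z w : F m z -> F m (w * z) by apply: (adic_mull (loc_central locg)).
have FD z w : F m z -> F m w -> F m (z + w).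
  exact: (@adicD R A' (fun r b => g (iA r) * b)).
have Ey : F m (E y).
  have h : E y * g f ^+ k + y * E (g f ^+ k) = 0 by rewrite -EM yk derivation1.
  have -> : E y = (- (y * y)) * E (g f ^+ k).
    rewrite -[LHS]mulr1 -yk.
    have -> : E y * (y * g f ^+ k) =
       y * (E y * g f ^+ k + y * E (g f ^+ k)) - y * y * E (g f ^+ k) by ring.
    by rewrite h mulr0 sub0r mulNr.
  by apply: (Fm); rewrite -(ring_homX _ _ gH).
rewrite -(subrK (y * g a) x) ED; apply: (FD).
  case: hx => s [hs ->]; rewrite (big_morph E ED E0).
  apply: (adic_sum (sm := fun r (b : A') => g (iA r) * b)) => p /hs hp.
  rewrite EM Er mul0r add0r.
  exact: (adicM (fun r (b : A') => g (iA r) * b)).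
by rewrite EM; apply: (FD); [rewrite mulrC|]; apply: (Fm).
Qed.

(** * Extension of the Poisson bracket *)

Variable br : A -> A -> A.
Hypothesis brP : poisson_bracket iA br.

Let brDl a b c : br (a + b) c = br a c + br b c. Proof. by case: brP => [[]]. Qed.
Let brDr a b c : br a (b + c) = br a b + br a c. Proof. by case: brP => [[]]. Qed.
Let braa a : br a a = 0. Proof. by case: brP. Qed.
Let brM a b c : br a (b * c) = br a b * c + b * br a c. Proof. by case: brP. Qed.
Let brC a b : br a b = - br b a.
Proof.
by apply/eqP; rewrite -addr_eq0; have := braa (a + b); rewrite brDl !brDr !braa add0r addr0 => ->.
Qed.
Let br1 a : br a 1 = 0.
Proof.
apply: (addrI (br a 1)); rewrite addr0.
by have := brM a 1 1; rewrite !mulr1 mul1r => <-.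
Qed.
Let brRr a r : br a (iA r) = 0.
Proof. by rewrite -[iA r]mulr1; case: brP => _ [_ ->] _ _ _; rewrite br1 mulr0. Qed.
Let brRl a r : br (iA r) a = 0.
Proof. by rewrite brC brRr oppr0. Qed.
Let brMl a b c : br (a * b) c = br a c * b + a * br b c.
Proof. by rewrite brC brM (brC a) (brC b); ring. Qed.

(** One variable at a time: [D a] extends the bracket with [a], then for each y the map a |-> D a y
    is extended. That the result is still a derivation in y follows from uniqueness in the other
    variable. *)
Lemma bracket_extension : exists B : A' -> A' -> A',
  [/\ forall y, derivation (B^~ y), forall x, derivation (B x) &
      forall a b, B (g a) (g b) = g (br a b)].
Proof.
have [|D hD] := @choice _ _ (fun a E => derivation E /\ forall b, E (g b) = g (br a b)).
  move=> a; apply: derivation_extension => [b c|b c|r].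
  - by rewrite brDr gD.
  - by rewrite brM gD !gM.
  - by rewrite brRr (ring_hom0 gH).
have [|B' hB'] := @choice _ _ (fun y E => derivation E /\ forall a, E (g a) = D a y).
  move=> y; apply: derivation_extension => [a b|a b|r].
  - move: y; apply: (derivation_eq (E2 := fun y => D a y + D b y)) => [||c].
    + by case: (hD (a + b)).
    + have [[[D1 M1] _] [[D2 M2] _]] := (hD a, hD b).
      by split=> x y; rewrite ?D1 ?D2 ?M1 ?M2; ring.
    + by rewrite !(hD _).2 brDl gD.
  - move: y; apply: (derivation_eq (E2 := fun y => D a y * g b + g a * D b y)) => [||c].
    + by case: (hD (a * b)).
    + have [[[D1 M1] _] [[D2 M2] _]] := (hD a, hD b).
      by split=> x y; rewrite ?D1 ?D2 ?M1 ?M2; ring.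
    + by rewrite !(hD _).2 brMl gD !gM.
  - apply: derivation_uniq; first by case: (hD (iA r)).
    by move=> c; rewrite (hD _).2 brRl (ring_hom0 gH).
exists (fun x y => B' y x); split.
- by move=> y; case: (hB' y).
- move=> x; split=> y z.
    move: x; apply: (derivation_eq (E2 := fun x => B' y x + B' z x)) => [||a].
    + by case: (hB' (y + z)).
    + have [[[D1 M1] _] [[D2 M2] _]] := (hB' y, hB' z).
      by split=> u v; rewrite ?D1 ?D2 ?M1 ?M2; ring.
    + by rewrite !(hB' _).2; case: (hD a) => [[-> _] _].
  move: x; apply: (derivation_eq (E2 := fun x => B' y x * z + y * B' z x)) => [||a].
  + by case: (hB' (y * z)).
  + have [[[D1 M1] _] [[D2 M2] _]] := (hB' y, hB' z).
    by split=> u v; rewrite ?D1 ?D2 ?M1 ?M2; ring.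
  + by rewrite !(hB' _).2; case: (hD a) => [[_ ->] _].
- by move=> a b; rewrite (hB' _).2 (hD _).2.
Qed.

Variable B : A' -> A' -> A'.
Hypotheses (Bl : forall y, derivation (B^~ y)) (Br : forall x, derivation (B x))
  (Bg : forall a b, B (g a) (g b) = g (br a b)).

Let BDl x y z : B (x + y) z = B x z + B y z. Proof. by case: (Bl z) => h _; apply: h. Qed.
Let BMl x y z : B (x * y) z = B x z * y + x * B y z. Proof. by case: (Bl z) => _ h; apply: h. Qed.
Let BDr x y z : B x (y + z) = B x y + B x z. Proof. by case: (Br x). Qed.
Let BMr x y z : B x (y * z) = B x y * z + y * B x z. Proof. by case: (Br x). Qed.
Let B0r y : B y 0 = 0. Proof. by apply: (addrI (B y 0)); rewrite -BDr !addr0. Qed.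
Let BNr x y : B y (- x) = - B y x.
Proof. by apply: (addrI (B y x)); rewrite -BDr !subrr B0r. Qed.

Lemma bracket_constr x r : B x (g (iA r)) = 0.
Proof.
move: x; apply: derivation_uniq => // a.
by rewrite Bg brRr (ring_hom0 gH).
Qed.

Lemma bracket_constl x r : B (g (iA r)) x = 0.
Proof.
move: x; apply: derivation_uniq => // a.
by rewrite Bg brRl (ring_hom0 gH).
Qed.

Lemma bracketC x y : B x y = - B y x.
Proof.
move: x; apply: (derivation_eq (E2 := fun x => - B y x)) => // [|a].
  by split=> u v; rewrite ?BDr ?BMr; ring.
move: y; apply: (derivation_eq (E2 := fun y => - B y (g a))) => // [|b].
  by split=> u v; rewrite ?BDl ?BMl; ring.
by rewrite !Bg brC (ring_homN _ gH).
Qed.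

(* In characteristic 2 this does not follow from antisymmetry; but
   [Q x = B x x] is additive with [Q (x y) = x^2 Q y + y^2 Q x]. *)
Lemma bracketxx x : B x x = 0.
Proof.
pose Q x := B x x.
have QD u v : Q (u + v) = Q u + Q v.
  by rewrite /Q BDl !BDr (bracketC v u); ring.
have QM u v : Q (u * v) = u * u * Q v + v * v * Q u.
  by rewrite /Q BMl !BMr (bracketC v u); ring.
have Qg a : Q (g a) = 0 by rewrite /Q Bg braa (ring_hom0 gH).
have Q0 : Q 0 = 0 by have := Qg 0; rewrite (ring_hom0 gH).
have [sepA' _] := loc_complete locg; apply: (sepA') => n; change (F (ideal_pow m n.+1) (Q x)).
have [y [a [[k yk] [s [hs ex]]]]] := loc_dense locg x n.+1.
have Qy : Q y = 0.
  (* Expand 0 = Q 1 = Q (y f^k), where Q (f^k) = 0 since f^k comes from [A]. *)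
  have h : g f ^+ k * g f ^+ k * Q y = 0.
    have := QM y (g f ^+ k); rewrite yk -{1}g1 Qg -(ring_homX _ _ gH) Qg mulr0 add0r => <- //.
  have -> : Q y = (y * g f ^+ k) * (y * g f ^+ k) * Q y by rewrite yk !mul1r.
  have -> : (y * g f ^+ k) * (y * g f ^+ k) * Q y = y * y * (g f ^+ k * g f ^+ k * Q y) by ring.
  by rewrite h mulr0.
rewrite -(subrK (y * g a) x) QD QM Qg Qy !mulr0 !addr0 ex (big_morph Q QD Q0).
apply: (adic_sum (sm := fun r (b : A') => g (iA r) * b)) => p /hs hp.
rewrite QM Qg mulr0 addr0 -mulrA.
exact: (adicM (fun r (b : A') => g (iA r) * b)).
Qed.

Let Jac x y z := B x (B y z) + B y (B z x) + B z (B x y).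

(** The products of two first-order brackets cancel by antisymmetry. With the cyclic symmetry of
    [Jac], the Jacobi identity can be checked on the image of [A], one variable after the other. *)
Let Jac_derivation y z : derivation (fun x => Jac x y z).
Proof.
split=> u v; rewrite /Jac.
  by rewrite !(BDl, BDr); ring.
rewrite !(BMl, BMr, BDl, BDr) (bracketC z v) (bracketC z u) (bracketC y v) (bracketC y u).
rewrite !(BNr); ring.
Qed.

Let Jac_cycle x y z : Jac x y z = Jac y z x.
Proof. by rewrite /Jac; ring. Qed.

Lemma bracket_jacobi x y z : Jac x y z = 0.
Proof.
move: x; apply: derivation_uniq => // a; rewrite Jac_cycle.
move: y; apply: derivation_uniq => // b; rewrite Jac_cycle.
move: z; apply: derivation_uniq => // c.
rewrite /Jac !Bg -!gD; case: brP => _ _ _ jac _.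
by rewrite jac (ring_hom0 gH).
Qed.

Lemma bracket_poisson : poisson_bracket (fun r => g (iA r)) B.
Proof.
split=> //.
- split=> r x y; first by rewrite BMl bracket_constl mul0r add0r.
  by rewrite BMr bracket_constr mul0r add0r.
- exact: bracketxx.
- exact: bracket_jacobi.
Qed.

Lemma bracket_sub_ideal : (forall a b, ideal_submod iA m (br a b)) ->
  forall x y, F m (B x y).
Proof.
move=> hbr x y; move: x; apply: derivation_sub_ideal => // [r|a].
  exact: bracket_constl.
move: y; apply: derivation_sub_ideal => // [r|b].
  exact: bracket_constr.
by rewrite Bg; apply: (ring_hom_submod gH).
Qed.

(** The defect g' (B x y) - br'' (g' x) (g' y) is a derivation along [g'] in each variable
    separately. *)
Lemma bracket_hom (A'' : comPzRingType) (iA'' : R -> A'') (br'' : A'' -> A'' -> A'')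
    (g' : A' -> A'') :
  ring_hom g' -> (forall r, g' (g (iA r)) = iA'' r) -> poisson_bracket iA'' br'' ->
  madic_complete m iA'' ->
  (forall a b, g' (g (br a b)) = br'' (g' (g a)) (g' (g b))) ->
  forall x y, g' (B x y) = br'' (g' x) (g' y).
Proof.
move=> g'H g'i [[bDl bDr] _ baa _ bM] [sep _] hgb x y.
have [g'D g'M g'1] := g'H.
have E : (fun r => g' (g (iA r))) = iA'' by apply: funext.
have bC a b : br'' a b = - br'' b a.
  by apply/eqP; rewrite -addr_eq0; have := baa (a + b); rewrite bDl !bDr !baa add0r addr0 => ->.
have bMl a b c : br'' (a * b) c = br'' a c * b + a * br'' b c.
  by rewrite bC bM (bC a) (bC b); ring.
apply/eqP; rewrite -subr_eq0; apply/eqP.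
move: x; apply: (@derivation_along_uniq A'' g' (fun x => g' (B x y) - br'' (g' x) (g' y))) => //.
- by rewrite E.
- by move=> u v; rewrite BDl !g'D bDl; ring.
- by move=> u v; rewrite BMl !g'D !g'M bMl; ring.
move=> a; move: y.
apply: (@derivation_along_uniq A'' g' (fun y => g' (B (g a) y) - br'' (g' (g a)) (g' y))) => //.
- by rewrite E.
- by move=> u v; rewrite BDr !g'D bDr; ring.
- by move=> u v; rewrite BMr !g'D !g'M bM; ring.
by move=> b; rewrite Bg hgb subrr.
Qed.

End Derivations.

(** The associative construction thus serves the Poisson case too; only the commutative structure is
    packed anew on the same carrier. *)
Lemma com_completed_localization (R : comPzRingType) (m : R -> Prop) (A : comPzRingType)
    (iA : R -> A) (f : A) (A' : pzRingType) (g : A -> A') :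
  completed_localization m iA f g ->
  exists (A'' : comPzRingType) (g' : A -> A''), completed_localization m iA f g'.
Proof.
case: A' g => T cT g loc; have mulC := loc_commutative loc (@mulrC A).
pose B : comPzRingType := HB.pack T cT
  (GRing.PzRing_hasCommutativeMul.Build (GRing.PzRing.Pack cT) mulC).
by exists B, g.
Qed.
Theorem theorem1p11 (K : fieldType) (R : comPzRingType) (iR : K -> R)
  (m : R -> Prop) (hR : parameter_algebra iR m)
  (C : comPzRingType) (iC : K -> C) (C' : comPzRingType) (iC' : K -> C')
  (tau : C -> C') (htau : kalg_hom iC iC' tau)
  (hloc : principal_localization tau) :
  (* Poisson case *)
  (forall (A : comPzRingType) (iA : R -> A) (br : A -> A -> A) (pi : A -> C),
    poisson_deformation iR m iC iA br pi ->
    exists (A' : comPzRingType) (iA' : R -> A') (br' : A' -> A' -> A')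
           (pi' : A' -> C') (g : A -> A'),
      [/\ poisson_deformation iR m iC' iA' br' pi',
          poisson_hom iA iA' br br' g,
          (forall a, pi' (g a) = tau (pi a)) &
          forall (C'' : comPzRingType) (iC'' : K -> C'') (tau' : C' -> C'')
                 (A'' : comPzRingType) (iA'' : R -> A'') (br'' : A'' -> A'' -> A'')
                 (pi'' : A'' -> C'') (h : A -> A''),
            kalg_hom iC' iC'' tau' ->
            poisson_deformation iR m iC'' iA'' br'' pi'' ->
            poisson_hom iA iA'' br br'' h ->
            (forall a, pi'' (h a) = tau' (tau (pi a))) ->
            exists! g' : A' -> A'',
              poisson_hom iA' iA'' br' br'' g' /\ forall a, h a = g' (g a)]) /\
  (* associative case *)
  (forall (A : pzRingType) (iA : R -> A) (pi : A -> C),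
    assoc_deformation iR m iC iA pi ->
    exists (A' : pzRingType) (iA' : R -> A') (pi' : A' -> C') (g : A -> A'),
      [/\ assoc_deformation iR m iC' iA' pi',
          ralg_hom iA iA' g,
          (forall a, pi' (g a) = tau (pi a)) &
          forall (C'' : comPzRingType) (iC'' : K -> C'') (tau' : C' -> C'')
                 (A'' : pzRingType) (iA'' : R -> A'') (pi'' : A'' -> C'')
                 (h : A -> A''),
            kalg_hom iC' iC'' tau' ->
            assoc_deformation iR m iC'' iA'' pi'' ->
            ralg_hom iA iA'' h ->
            (forall a, pi'' (h a) = tau' (tau (pi a))) ->
            exists! g' : A' -> A'',
              ralg_hom iA' iA'' g' /\ forall a, h a = g' (g a)]).
Proof.
have [s [s_unit s_frac s_ker]] := hloc; split.
- move=> A iA br pi [defA brP pi_br].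
  have [f pi_f] : exists f, pi f = s by case: defA => _ _ _ [_ h] _.
  have [A0 [g0 loc0]] := exists_deformation_localization hR defA f.
  have [A' [g locg]] := com_completed_localization loc0.
  have [pi' [defA' pi'g]] :=
    localization_augmentation hR htau s_unit s_frac s_ker defA pi_f locg.
  have homA := deformation_hom defA; have hm := parameter_ideal hR.
  have [B [Bl Br Bg]] := bracket_extension homA locg brP.
  have [gH gC] := (loc_hom locg, loc_central locg).
  exists A', (fun r => g (iA r)), B, pi', g; split=> //.
  + split=> //; first exact: (bracket_poisson locg brP Bl Br Bg).
    move=> x y; have [_ _ _ _ ker] := defA'; apply/ker.
    apply: (bracket_sub_ideal hm locg brP Bl Br Bg) => a b.
    by have [_ _ _ _ kerA] := defA; apply/kerA/pi_br.
  + by split=> [|a b]; [split | rewrite Bg].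
  + move=> C'' iC'' tau' A'' iA'' br'' pi'' h htau' [defA'' brP'' _] [hh hbr] hpi.
    have [g' [[[g'H g'i] hg'] uniq]] :=
      localization_universal hR s_unit pi_f locg htau' defA'' hh hpi.
    (* Uniqueness is inherited from algebra homomorphisms; what is left is that [g'] respects the
       brackets. *)
    exists g'; split; last by move=> g2 [[hg2 _] g2g]; apply: uniq.
    split=> //; split=> //.
    apply: (bracket_hom locg Bl Br Bg g'H g'i brP'') => [|a b].
      by case: defA''.
    by rewrite -!hg' hbr.
- move=> A iA pi defA.
  have [f pi_f] : exists f, pi f = s by case: defA => _ _ _ [_ h] _.
  have [A' [g locg]] := exists_deformation_localization hR defA f.
  have [pi' [defA' pi'g]] :=
    localization_augmentation hR htau s_unit s_frac s_ker defA pi_f locg.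
  exists A', (fun r => g (iA r)), pi', g; split=> //; first by split=> //; apply: loc_hom locg.
  move=> C'' iC'' tau' A'' iA'' pi'' h htau' defA'' hh hpi.
  exact: (localization_universal hR s_unit pi_f locg htau' defA'' hh hpi).
Qed.
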